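(* Let $d\ge 1$ be an integer, and let $c:(0,\infty)\to(0,\infty)$ be a $C^1$ function such that $c'<0$ on $(0,\infty)$, $c/c'$ is convex on $(0,\infty)$, and $\lim_{x\to 0+}c(x)<\infty$. Set $$u(t,x)=\int_0^x c(y)^{e^{2t}}\,dy,\qquad t\ge 0,\ x>0,$$ and for every $t\ge 0$ let $v(t,\cdot)$ be the inverse function of $x\mapsto u(t,x)$, $x>0$. Then for any $f\in C^1_{b,0}(\mathbb{R}^d)$, $$v\bigl(t,\|u(t,Q_tf)\|_1\bigr)\ge v\bigl(0,\|u(0,f)\|_1\bigr)\qquad\text{for all } t\ge 0.$$
   Context: $\gamma_d$ is the standard Gaussian measure on $\mathbb{R}^d$ and $\|g\|_1=\int|g|\,d\gamma_d$. The Ornstein-Uhlenbeck semigroup is $$(Q_tf)(x)=\int_{\mathbb{R}^d}f\bigl(e^{-t}x+\sqrt{1-e^{-2t}}\,y\bigr)\,\gamma_d(dy),\qquad t\ge 0.$$ $C^1_{b,0}(\mathbb{R}^d)$ is the set of bounded $C^1$ functions $f:\mathbb{R}^d\to\mathbb{R}$ with bounded derivatives and $\inf_{x\in\mathbb{R}^d}f(x)>0$. The inverse $v(t,\cdot)$ is defined on the range of $u(t,\cdot)$. *)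

(* Defs.v *)
From HB Require Import structures.
From mathcomp Require Import all_boot all_order all_algebra.
From mathcomp Require Import all_classical all_reals all_analysis.

Set Implicit Arguments.
Unset Strict Implicit.
Unset Printing Implicit Defensive.

Import Order.TTheory GRing.Theory Num.Theory.
Import numFieldNormedType.Exports.

Local Open Scope classical_set_scope.
Local Open Scope ring_scope.

Section tuple_cons.
Context {R : realType} (n : nat).
Local Notation T := (measurableTypeR R).

Definition tcons (p : T * n.-tuple T) : n.+1.-tuple T := [tuple of p.1 :: p.2].

Lemma measurable_tcons : measurable_fun [set: T * n.-tuple T] tcons.
Proof. exact: measurable_cons. Qed.

HB.instance Definition _ := isMeasurableFun.Build _ _ _ _ tcons measurable_tcons.

End tuple_cons.

(** The standard Gaussian measure on R^d, as the [d]-fold product of the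
    standard normal distribution, on the product sigma-algebra of [d.-tuple].
    For [d = 0] it is the point mass at the empty tuple. *)
Fixpoint gaussian (R : realType) (d : nat) :
    probability (d.-tuple (measurableTypeR R)) R :=
  match d with
  | 0 => dirac [tuple]
  | n.+1 =>
      distribution (normal_prob (0 : R) 1 \x gaussian R n)%E (@tcons R n)
  end.

(** R^d is ['rV[R]_d] for topology and calculus, and [d.-tuple] for measure
    theory; integrals transport the integrand along this bijection. *)
Definition row_of_tuple (R : realType) (d : nat)
    (y : d.-tuple (measurableTypeR R)) : 'rV[R]_d := \row_i tnth y i.

Definition gaussian_integral (R : realType) (d : nat) (g : 'rV[R]_d -> R) : R :=
  \int[gaussian R d]_y g (row_of_tuple y).

Definition gaussian_norm1 (R : realType) (d : nat) (g : 'rV[R]_d -> R) : R :=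
  gaussian_integral (fun x => `|g x|).

Definition ornstein_uhlenbeck (R : realType) (d : nat) (t : R)
    (f : 'rV[R]_d -> R) (x : 'rV[R]_d) : R :=
  gaussian_integral
    (fun y => f (expR (- t) *: x + Num.sqrt (1 - expR (- (2 * t))) *: y)).

Definition partial (R : realType) (d : nat) (i : 'I_d) (f : 'rV[R]_d -> R)
    (x : 'rV[R]_d) : R := 'D_(delta_mx 0 i) f x.

Record C1b0 (R : realType) (d : nat) (f : 'rV[R]_d -> R) : Prop := {
  C1b0_bounded : bounded_fun f;
  C1b0_derivable : forall (i : 'I_d) x, derivable f x (delta_mx 0 i);
  C1b0_partial_continuous : forall i : 'I_d, continuous (partial i f);
  C1b0_partial_bounded : forall i : 'I_d, bounded_fun (partial i f);
  C1b0_inf_gt0 : 0 < inf (range f) }.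

(** Functions on (0, +oo) are total functions whose values outside (0, +oo)
    are irrelevant; this is why [u] integrates over the open interval. *)
Definition C1_pos (R : realType) (c : R -> R) : Prop :=
  forall x, 0 < x -> derivable c x 1 /\ {for x, continuous c^`()%classic}.

Definition u (R : realType) (c : R -> R) (t x : R) : R :=
  \int[lebesgue_measure]_(y in `]0, x[) c y `^ expR (2 * t).

(* Main.v *)
Require Import Defs.
From HB Require Import structures.
From mathcomp Require Import all_boot all_order all_algebra.
From mathcomp Require Import all_classical all_reals all_analysis.
From mathcomp Require Import measurable_realfun.
From mathcomp Require Import ring lra.
Import Order.TTheory GRing.Theory Num.Theory.
Import numFieldNormedType.Exports.
Local Open Scope classical_set_scope.
Local Open Scope ring_scope.

(** Write [p = expR (2 * t)], [P_s] for the heat semigroup [heat s] and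
    [M_s g = w (P_s (u g))] for the nonlinear average attached to [u = u c 0]
    with inverse [w], [U_s] being its analogue for [u c t].  At the origin, the
    two sides of the inequality are [U_(1/p) P_(1-1/p) f] and [M_1 f]; they are
    the ends of the path [U_(r/p) P_(r-r/p) M_(1-r) f], [0 <= r <= 1], and it is
    enough that each step of length [d] along this path decreases it by at most
    [o(d)].  Since [M_d g] is [P_d g + q (P_d g) Var / 2] up to [o(d)], with
    [q = c' / c], and likewise for [U_(d/p)] with [p * q], a step reduces to two
    facts about variances: the contraction
    [p * Var_(d/p) (P_(d-d/p) g) <= Var_d g], which follows from convexity of
    [s |-> Var_s (P_(d-s) g)] (an Efron-Stein inequality), and
    [P_s (Var_h k / rho (P_h k)) >= Var_h (P_s k) / rho (P_(s+h) k)], which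
    holds because [(m, x) |-> x^2 / rho m] is jointly convex when
    [rho = - c / c'] is concave. *)

Set Implicit Arguments.
Unset Strict Implicit.
Unset Printing Implicit Defensive.

(** * Stability of the normal distribution *)

Section normal.
Context {R : realType}.
Local Notation mu := (@lebesgue_measure R).
Local Notation T := (measurableTypeR R).


Lemma ge0_integral_normal_prob (m s : R) (g : T -> \bar R) :
  measurable_fun [set: T] g -> (forall x, 0 <= g x)%E ->
  (\int[normal_prob m s]_x g x = \int[mu]_x (g x * (normal_pdf m s x)%:E))%E.
Proof.
move=> mg g0.
have dom := normal_prob_dominates m s.
rewrite -(Radon_Nikodym_SigmaFinite.change_of_variables dom)//.
apply: ae_eq_integral => //.
- apply: emeasurable_funM => //; apply: (measurable_int mu).
  exact: Radon_Nikodym_SigmaFinite.f_integrable.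
- by apply: emeasurable_funM => //; apply/measurable_EFinP; exact: measurable_normal_pdf.
- apply: ae_eqe_mul2l; apply: integral_ae_eq => //=.
  + exact: Radon_Nikodym_SigmaFinite.f_integrable.
  + by apply/measurable_EFinP; exact: measurable_normal_pdf.
  + by move=> A _ mA; rewrite -Radon_Nikodym_SigmaFinite.f_integral.
Qed.

Lemma ge0_integral_affine (G : R -> R) (s m : R) : 0 < s ->
  continuous G -> (forall x, 0 <= G x) ->
  (\int[mu]_x (G x)%:E = \int[mu]_x (G (s * x + m) * s)%:E)%E.
Proof.
move=> s0 cG G0; pose F x := s * x + m.
have dF x : is_derive x (1 : R) F s.
  have -> : F = (fun x : R => s *: x) + cst m by [].
  by apply: is_derive_eq; rewrite /GRing.scale/= mulr1 addr0.
have F'E : F^`()%classic = cst s.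
  by apply/funext => x; rewrite derive1E; exact: derive_val.
have -> : (\int[mu]_x (G (s * x + m) * s)%:E =
           \int[mu]_x (((G \o F) * F^`()%classic) x)%:E)%E.
  by apply: eq_integral => x _; rewrite F'E.
apply: increasing_ge0_integration_by_substitutionT => //.
- by move=> x y xy; rewrite /F ltrD2r ltr_pM2l.
- by rewrite F'E => ?; exact: cvg_cst.
- by rewrite F'E; exact: is_cvg_cst.
- by rewrite F'E; exact: is_cvg_cst.
- have -> : F = (fun x => x + m) \o (fun x => s * x) by [].
  apply: (cvg_comp _ _ _ (cvg_addrr_Ny m)).
  by apply: gt0_cvgMrNy => //; exact: cvg_id.
- have -> : F = (fun x => x + m) \o (fun x => s * x) by [].
  apply: (cvg_comp _ _ _ (cvg_addrr m)).
  by apply: gt0_cvgMry => //; exact: cvg_id.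
Qed.

Lemma normal_pdf_affine (m s x : R) : 0 < s ->
  normal_pdf 0 1 x * s^-1 = normal_pdf m s (s * x + m).
Proof.
move=> s0; rewrite /normal_pdf (gt_eqF s0) (gt_eqF ltr01) mulrAC; congr (_ * _).
  rewrite /normal_peak expr1n mul1r -mulrnAr sqrtrM ?sqr_ge0// sqrtr_sqr.
  by rewrite (gtr0_norm s0) invfM mulrC.
rewrite /normal_fun subr0 addrK expr1n exprMn.
congr expR; field.
by rewrite gt_eqF.
Qed.

Lemma normal_pdf_swap (a b c x z : R) : 0 < b -> 0 < c ->
  c ^+ 2 = a ^+ 2 + b ^+ 2 ->
  normal_pdf 0 1 x * normal_pdf (a * x / c) (b / c) z =
  normal_pdf 0 1 z * normal_pdf (a * z / c) (b / c) x.
Proof.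
move=> b0 c0 cE; have bc0 : 0 < b / c by rewrite divr_gt0.
rewrite /normal_pdf (gt_eqF bc0) (gt_eqF ltr01) mulrACA [RHS]mulrACA.
congr (_ * _); rewrite /normal_fun -!expRD; congr expR.
rewrite expr1n !subr0 !mulr2n.
have E (v w : R) : - v ^+ 2 / (1 + 1) +
      - (w - a * v / c) ^+ 2 / ((b / c) ^+ 2 + (b / c) ^+ 2) =
    - ((c ^+ 2 * v ^+ 2) + c ^+ 2 * w ^+ 2 - 2 * a * c * v * w) /
      (b ^+ 2 * 2).
  rewrite [X in X + c ^+ 2 * w ^+ 2](_ : _ = (a ^+ 2 + b ^+ 2) * v ^+ 2).
    by field; rewrite -mulr2n mulrn_eq0 expf_eq0 (gt_eqF b0) (gt_eqF c0).
  by rewrite cE.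
by rewrite !E; congr (- _ / _); ring.
Qed.

End normal.

Section normal_stable.
Context {R : realType}.
Local Notation mu := (@lebesgue_measure R).
Local Notation T := (measurableTypeR R).

Lemma ge0_normal_prob_stable (h : R -> R) (a b c : R) : 0 < b -> 0 < c ->
  c ^+ 2 = a ^+ 2 + b ^+ 2 -> continuous h -> (forall x, 0 <= h x) ->
  (\int[normal_prob 0 1]_x \int[normal_prob 0 1]_y (h (a * x + b * y))%:E =
   \int[normal_prob 0 1]_z (h (c * z))%:E)%E.
Proof.
move=> b0 c0 cE ch h0.
have bn0 : b != 0 by rewrite gt_eqF.
have cn0 : c != 0 by rewrite gt_eqF.
have clin (u v : R) : continuous (fun y : R => u + v * y).
  move=> y; apply: cvgD; first exact: cvg_cst.
  by apply: cvgM; [exact: cvg_cst|exact: cvg_id].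
have mh : measurable_fun [set: T] h by exact: continuous_measurable_fun.
have mhc : measurable_fun [set: T] (fun z => h (c * z)).
  by apply: measurableT_comp => //; exact: measurable_funM.
have mker : measurable_fun [set: T * T]
    (fun w : T * T => normal_pdf (a * w.2 / c) (b / c) w.1).
  have -> : (fun w : T * T => normal_pdf (a * w.2 / c) (b / c) w.1) =
      normal_pdf 0 (b / c) \o (fun w => w.1 - a * w.2 / c).
    apply/funext => w /=; rewrite /normal_pdf gt_eqF ?divr_gt0//.
    by rewrite /normal_fun subr0.
  apply: measurableT_comp; first exact: measurable_normal_pdf.
  apply: measurable_funB => //.
  by apply: measurable_funM => //; exact: measurable_funM.
have inner x : (\int[normal_prob 0 1]_y (h (a * x + b * y))%:E =
    \int[mu]_z (h (c * z) * normal_pdf (a * x / c) (b / c) z)%:E)%E.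
  rewrite ge0_integral_normal_prob; last 2 first.
  - apply/measurable_EFinP; apply: measurableT_comp => //.
    exact: continuous_measurable_fun.
  - by move=> y; rewrite lee_fin.
  pose G y := h (a * x + b * y) * normal_pdf 0 1 y.
  transitivity (\int[mu]_y (G y)%:E)%E.
    by apply: eq_integral => y _; rewrite EFinM.
  rewrite (@ge0_integral_affine _ G (c / b) (- (a * x / b))); first last.
  - by move=> y; rewrite /G mulr_ge0// normal_pdf_ge0.
  - move=> y; apply: cvgM.
      apply: (cvg_comp _ h); first exact: clin.
      exact: ch.
    exact: continuous_normal_pdf (oner_neq0 _) _.
  - by rewrite divr_gt0.
  apply: eq_integral => z _; congr EFin; rewrite /G -mulrA; congr (h _ * _).
    by field.
  rewrite -[c / b]invrK invf_div (@normal_pdf_affine _ (a * x / c)) ?divr_gt0//.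
  by congr normal_pdf; field; rewrite cn0 bn0.
rewrite [LHS]ge0_integral_normal_prob; last 2 first.
- apply: (@measurable_fun_fubini_tonelli_F _ _ _ _ R (normal_prob 0 1)
     (fun w : T * T => (h (a * w.1 + b * w.2))%:E)) => //.
    apply/measurable_EFinP; apply: measurableT_comp => //.
    by apply: measurable_funD; exact: measurable_funM.
  by move=> w; rewrite lee_fin.
- by move=> x; apply: integral_ge0 => y _; rewrite lee_fin.
transitivity (\int[mu]_x \int[mu]_z (h (c * z) * normal_pdf 0 1 z *
    normal_pdf (a * z / c) (b / c) x)%:E)%E.
  apply: eq_integral => x _; rewrite inner.
  rewrite -ge0_integralZr; first last.
  - by rewrite lee_fin normal_pdf_ge0.
  - by move=> z _; rewrite lee_fin mulr_ge0// normal_pdf_ge0.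
  - apply/measurable_EFinP/measurable_funM => //.
    exact: measurable_normal_pdf.
  - exact: measurableT.
  apply: eq_integral => z _; rewrite -EFinM; congr EFin.
  rewrite -[LHS]mulrA -[RHS]mulrA; congr (_ * _); rewrite [LHS]mulrC.
  exact: normal_pdf_swap.
rewrite (fubini_tonelli (fun w : T * T => (h (c * w.2) * normal_pdf 0 1 w.2 *
    normal_pdf (a * w.2 / c) (b / c) w.1)%:E))/=; last 2 first.
- apply/measurable_EFinP/measurable_funM; last first.
    exact: mker.
  apply: measurable_funM; first exact: (measurableT_comp mhc measurable_snd).
  exact: (measurableT_comp (measurable_normal_pdf _ _) measurable_snd).
- by move=> w; rewrite lee_fin !mulr_ge0// normal_pdf_ge0.
rewrite ge0_integral_normal_prob; last 2 first.
- exact/measurable_EFinP.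
- by move=> z; rewrite lee_fin.
apply: eq_integral => z _.
under eq_integral do rewrite EFinM.
rewrite ge0_integralZl; first last.
- by rewrite lee_fin mulr_ge0// normal_pdf_ge0.
- by move=> x _; rewrite lee_fin normal_pdf_ge0.
- by apply/measurable_EFinP; exact: measurable_normal_pdf.
- exact: measurableT.
by rewrite integral_normal_pdf mule1 EFinM.
Qed.

End normal_stable.

Section bmeas.
Context {R : realType}.

Definition bmeas d (T : measurableType d) (F : T -> R) :=
  measurable_fun [set: T] F /\ exists B, forall x, `|F x| <= B.

Section closure.
Context d (T : measurableType d).
Implicit Types F G : T -> R.

Lemma bmeas_cst r : bmeas (fun _ : T => r).
Proof. by split; [exact: measurable_cst|exists `|r|]. Qed.

Lemma bmeasD F G : bmeas F -> bmeas G -> bmeas (fun x => F x + G x).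
Proof.
move=> [mF [B FB]] [mG [C GC]]; split; first exact: measurable_funD.
by exists (B + C) => x; rewrite (le_trans (ler_normD _ _))// lerD.
Qed.

Lemma bmeasM F G : bmeas F -> bmeas G -> bmeas (fun x => F x * G x).
Proof.
move=> [mF [B FB]] [mG [C GC]]; split; first exact: measurable_funM.
by exists (B * C) => x; rewrite normrM ler_pM.
Qed.

Lemma bmeasZ r F : bmeas F -> bmeas (fun x => r * F x).
Proof. by apply: bmeasM; exact: bmeas_cst. Qed.

Lemma bmeasB F G : bmeas F -> bmeas G -> bmeas (fun x => F x - G x).
Proof.
move=> mF mG; rewrite (_ : (fun _ => _) = fun x => F x + (-1) * G x).
  by apply: bmeasD => //; exact: bmeasZ.
by apply/funext => x; rewrite mulN1r.
Qed.

Lemma bmeasX F n : bmeas F -> bmeas (fun x => F x ^+ n).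
Proof.
move=> mF; elim: n => [|n IH]; first exact: bmeas_cst.
rewrite (_ : (fun _ => _) = fun x => F x * F x ^+ n); first exact: bmeasM.
by apply/funext => x; rewrite exprS.
Qed.

End closure.

Lemma bmeas_integrable d (T : measurableType d) (P : probability T R) F :
  bmeas F -> P.-integrable [set: T] (EFin \o F).
Proof.
move=> [mF [B FB]]; apply: measurable_bounded_integrable => //.
  by rewrite -ge0_fin_numE// fin_num_measure.
by exists B; split=> [|M BM x _ /=]; rewrite ?num_real// (le_trans (FB x))// ltW.
Qed.

Section fubini.
Context d1 d2 (T1 : measurableType d1) (T2 : measurableType d2).
Context (P1 : probability T1 R) (P2 : probability T2 R).
Variables (F : T1 * T2 -> R) (bF : bmeas F).

Lemma bmeas_section x : bmeas (fun y => F (x, y)).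
Proof.
case: bF => mF [B FB]; split; last by exists B.
exact: (measurableT_comp mF (measurable_pair1 x)).
Qed.

Lemma bmeas_section2 y : bmeas (fun x => F (x, y)).
Proof.
case: bF => mF [B FB]; split; last by exists B.
exact: (measurableT_comp mF (measurable_pair2 y)).
Qed.

Let iF : (P1 \x P2)%E.-integrable [set: T1 * T2] (EFin \o F).
Proof. exact: bmeas_integrable. Qed.

Let bound B x : (forall z, `|F z| <= B) -> `|\int[P2]_y F (x, y)| <= B.
Proof.
move=> FB; apply: le_trans; first exact/le_normr_Rintegral/bmeas_integrable/bmeas_section.
rewrite -[leRHS](mulr1 B) -[1]/(fine 1) -(@probability_setT _ _ _ P2).
rewrite -Rintegral_cst//; apply: le_Rintegral => //.
- apply: bmeas_integrable; case: (bmeas_section x) => m [C FC].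
  by split; [exact: measurableT_comp|exists C => y; rewrite normr_id].
- exact/bmeas_integrable/bmeas_cst.
Qed.

Lemma bmeas_Rintegral : bmeas (fun x => \int[P2]_y F (x, y)).
Proof.
split; last by case: bF => _ [B FB]; exists B => x; exact: bound.
apply: measurableT_comp; first exact: fine_measurable.
exact: (measurable_fubini_F iF).
Qed.

End fubini.

Lemma integral_probability_cst d (T : measurableType d)
  (P : probability T R) (r : \bar R) : (\int[P]_x r = r)%E.
Proof.
rewrite integral_cst//; transitivity (r * 1)%E; last by rewrite mule1.
by congr (_ * _)%E; exact: probability_setT.
Qed.

Lemma Rintegral_probability_cst d (T : measurableType d)
  (P : probability T R) (r : R) : \int[P]_x r = r.
Proof. by rewrite /Rintegral integral_probability_cst. Qed.

Lemma EFin_Rintegral d (T : measurableType d) (P : probability T R) F :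
  bmeas F -> (\int[P]_x F x)%:E = (\int[P]_x (F x)%:E)%E.
Proof.
by move=> bF; rewrite fineK//; apply: integrable_fin_num => //; exact: bmeas_integrable.
Qed.

Lemma Rintegral_Fubini d1 d2 (T1 : measurableType d1) (T2 : measurableType d2)
    (P1 : probability T1 R) (P2 : probability T2 R) (F : T1 * T2 -> R) :
  bmeas F ->
  \int[P1]_x \int[P2]_y F (x, y) = \int[P2]_y \int[P1]_x F (x, y).
Proof.
move=> bF; rewrite {1}/Rintegral [in RHS]/Rintegral; congr fine.
transitivity (\int[P1]_x \int[P2]_y (F (x, y))%:E)%E.
  by apply: eq_integral => x _; rewrite EFin_Rintegral//; exact: bmeas_section.
transitivity (\int[P2]_y \int[P1]_x (F (x, y))%:E)%E; last first.
  by apply: eq_integral => x _; rewrite EFin_Rintegral//; exact: bmeas_section2.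
exact: (Fubini (bmeas_integrable (P1 \x P2)%E bF)).
Qed.

Lemma normal_prob_stable (h : R -> R) (a b c : R) : 0 < b -> 0 < c ->
  c ^+ 2 = a ^+ 2 + b ^+ 2 -> continuous h -> (exists B, forall x, `|h x| <= B) ->
  \int[normal_prob 0 1]_x \int[normal_prob 0 1]_y h (a * x + b * y) =
  \int[normal_prob 0 1]_z h (c * z).
Proof.
move=> b0 c0 cE ch [B hB].
have mh : measurable_fun [set: measurableTypeR R] h.
  exact: continuous_measurable_fun.
have b1 u : bmeas (fun z : measurableTypeR R => h (u * z)).
  split; last by exists B.
  by apply: measurableT_comp => //; exact: measurable_funM.
have b2 : bmeas (fun z : measurableTypeR R * measurableTypeR R =>
    h (a * z.1 + b * z.2)).
  split; last by exists B.
  apply: measurableT_comp => //.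
  by apply: measurable_funD; exact: measurable_funM.
pose h' x := h x + B.
have := @ge0_normal_prob_stable _ h' _ _ _ b0 c0 cE.
have ch' : continuous h' by move=> x; apply: cvgD; [exact: ch|exact: cvg_cst].
have h'0 x : 0 <= h' x by rewrite /h' -lerBlDr sub0r; have := hB x; rewrite ler_norml => /andP[].
move=> /(_ ch' h'0).
have N1 : \int[normal_prob 0 1]_x (B : R) = B.
  exact: (Rintegral_probability_cst (normal_prob 0 1)).
have {}E x : (\int[normal_prob 0 1]_y (h' (a * x + b * y))%:E =
    (\int[normal_prob 0 1]_y h (a * x + b * y) + B)%:E)%E.
  rewrite -EFin_Rintegral; last first.
    by apply: bmeasD; [exact: (bmeas_section b2)|exact: bmeas_cst].
  rewrite RintegralD//.
  - by rewrite N1.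
  - exact/bmeas_integrable/(bmeas_section b2).
  - exact/bmeas_integrable/bmeas_cst.
under eq_integral do rewrite E.
rewrite -EFin_Rintegral; last first.
  by apply: bmeasD; [exact: (bmeas_Rintegral (normal_prob 0 1) (normal_prob 0 1) b2)|exact: bmeas_cst].
rewrite -EFin_Rintegral; last by apply: bmeasD; [exact: b1|exact: bmeas_cst].
rewrite RintegralD//; last 2 first.
- exact/bmeas_integrable/(bmeas_Rintegral (normal_prob 0 1) (normal_prob 0 1) b2).
- exact/bmeas_integrable/bmeas_cst.
rewrite RintegralD//; last 2 first.
- exact/bmeas_integrable/b1.
- exact/bmeas_integrable/bmeas_cst.
by rewrite N1 => -[] /addIr.
Qed.

End bmeas.

(** * Gaussian integrals of Lipschitz functions *)

Section norm1.
Context {R : realType} (n : nat).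
Implicit Types x y : 'rV[R]_n.

Definition norm1 x : R := \sum_i `|x 0 i|.

Lemma norm1_ge0 x : 0 <= norm1 x.
Proof. exact: sumr_ge0. Qed.

Lemma norm1Z (r : R) x : norm1 (r *: x) = `|r| * norm1 x.
Proof.
by rewrite /norm1 mulr_sumr; apply: eq_bigr => i _; rewrite mxE normrM.
Qed.

Definition lip1 (L : R) (g : 'rV[R]_n -> R) :=
  forall x y, `|g x - g y| <= L * norm1 (x - y).

Lemma rat_dense_norm1 x (e : R) : 0 < e ->
  exists q : 'rV[rat]_n, norm1 (x - map_mx ratr q) <= e.
Proof.
move=> e0; pose d := e / n.+1%:R.
have d0 : 0 < d by rewrite divr_gt0.
have h i : {q : rat | ratr q \in `]x 0 i, (x 0 i + d)[}.
  by apply: cid; have [|q] := @rat_in_itvoo R (x 0 i) (x 0 i + d);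
    [rewrite ltrDl|exists q].
exists (\row_i projT1 (h i)).
rewrite /norm1 (@le_trans _ _ (\sum_(i < n) d))//.
  apply: ler_sum => i _; rewrite !mxE.
  case: (h i) => q /=; rewrite in_itv/= => /andP[xq qx].
  by rewrite distrC ger0_norm ?subr_ge0 ?(ltW xq)// lerBlDl ltW.
rewrite sumr_const card_ord -[leLHS]mulr_natr /d mulrAC ler_pdivrMr//.
by rewrite ler_wpM2l ?(ltW e0)// ler_nat.
Qed.

(* McShane: a Lipschitz function is a countable infimum of cones
   [g q + L |x - q|]. *)
Lemma lip1_measurable d (T : measurableType d) (X : T -> 'rV[R]_n) L g :
  0 <= L -> (forall i, measurable_fun [set: T] (fun t => X t 0 i)) ->
  lip1 L g -> measurable_fun [set: T] (g \o X).
Proof.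
move=> L0 mX Lg.
pose q (k : nat) : 'rV[R]_n := map_mx ratr (odflt 0 (@unpickle 'rV[rat]_n k)).
pose h (k : nat) t := g (q k) + L * norm1 (X t - q k).
have hge k t : g (X t) <= h k t.
  rewrite /h -lerBlDl; apply: le_trans (Lg _ _).
  exact: ler_norm.
have lbh t : has_lbound (range (h ^~ t)).
  by exists (g (X t)) => _ [k _ <-].
have -> : g \o X = fun t => infs (h ^~ t) 0%N.
  apply/funext => t /=; apply/eqP; rewrite eq_le; apply/andP; split.
    apply: lb_le_inf; first by exists (h 0%N t) => /=; exists 0%N.
    by move=> _ [k _ <-].
  apply/ler_addgt0Pl => e e0.
  have L1 : 0 < L *+ 2 + 1 by rewrite ltr_wpDl// mulrn_wge0.
  have [v xv] := @rat_dense_norm1 (X t) (e / (L *+ 2 + 1)) (divr_gt0 e0 L1).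
  apply: (@le_trans _ _ (h (pickle v) t)).
    apply: ge_inf; last by exists (pickle v).
    by exists (g (X t)) => _ [k _ <-].
  rewrite /h /q pickleK/=; set w := map_mx _ _.
  have gw : g w <= g (X t) + L * norm1 (X t - w).
    rewrite -lerBlDl; apply: le_trans (ler_norm _) _.
    by rewrite distrC.
  apply: (@le_trans _ _ ((L *+ 2) * norm1 (X t - w) + g (X t))); first lra.
  rewrite lerD2r; apply: (@le_trans _ _ ((L *+ 2 + 1) * norm1 (X t - w))).
    by rewrite ler_wpM2r ?norm1_ge0// lerDl.
  by rewrite mulrC -ler_pdivlMr.
apply: measurable_fun_infs => // k.
apply: measurable_funD; first exact: measurable_cst.
apply: measurable_funM; first exact: measurable_cst.
rewrite (_ : (fun _ => _) = fun t => \sum_(i < n) `|X t 0 i - q k 0 i|).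
  apply: measurable_sum => i; apply: measurableT_comp => //.
  by apply: measurable_funB => //; exact: measurable_cst.
by apply/funext => t; apply: eq_bigr => i _; rewrite !mxE.
Qed.

End norm1.

Section gaussian_cons.
Context {R : realType}.
Local Notation T := (measurableTypeR R).

Definition vcons n (x : R) (y : 'rV[R]_n) : 'rV[R]_n.+1 :=
  \row_i oapp (fun j => y 0 j) x (unlift ord0 i).

Lemma row_of_tcons n (z : T * n.-tuple T) :
  row_of_tuple (tcons z) = vcons z.1 (row_of_tuple z.2).
Proof.
apply/rowP => i; rewrite !mxE.
case: unliftP => [j ->|->] /=; last by rewrite tnth0.
by rewrite tnthS !mxE.
Qed.

Lemma norm1_vcons n (x : R) (y : 'rV[R]_n) : norm1 (vcons x y) = `|x| + norm1 y.
Proof.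
rewrite /norm1 big_ord_recl mxE unlift_none/=; congr (_ + _).
by apply: eq_bigr => i _; rewrite mxE liftK.
Qed.

Lemma vconsD n (x x' : R) (y y' : 'rV[R]_n) :
  vcons x y + vcons x' y' = vcons (x + x') (y + y').
Proof. by apply/rowP => i; rewrite !mxE; case: unliftP => //= j; rewrite mxE. Qed.

Lemma vconsZ n (a x : R) (y : 'rV[R]_n) : a *: vcons x y = vcons (a * x) (a *: y).
Proof. by apply/rowP => i; rewrite !mxE; case: unliftP => //= j; rewrite mxE. Qed.

Lemma vconsN n (x : R) (y : 'rV[R]_n) : - vcons x y = vcons (- x) (- y).
Proof. by apply/rowP => i; rewrite !mxE; case: unliftP => //= j; rewrite mxE. Qed.

Lemma measurable_row_of_tuple n i :
  measurable_fun [set: n.-tuple T] (fun y => row_of_tuple y 0 i).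
Proof.
rewrite (_ : (fun _ => _) = (fun y : n.-tuple T => tnth y i)).
  exact: measurable_tnth.
by apply/funext => y; rewrite mxE.
Qed.

Lemma measurable_vcons d (S : measurableType d) n (f : S -> R) (X : S -> 'rV[R]_n) :
  measurable_fun [set: S] f ->
  (forall i, measurable_fun [set: S] (fun t => X t 0 i)) ->
  forall i, measurable_fun [set: S] (fun t => vcons (f t) (X t) 0 i).
Proof.
move=> mf mX i; case: (unliftP ord0 i) => [j ->|->].
  rewrite (_ : (fun _ => _) = (fun t => X t 0 j)) //.
  by apply/funext => t; rewrite mxE liftK.
rewrite (_ : (fun _ => _) = f) //.
by apply/funext => t; rewrite mxE unlift_none.
Qed.

Definition gbmeas n (g : 'rV[R]_n -> R) := bmeas (g \o @row_of_tuple R n).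

Lemma gaussian_integral_cons n (g : 'rV[R]_n.+1 -> R) : gbmeas g ->
  gaussian_integral g =
  \int[normal_prob 0 1]_x gaussian_integral (fun y => g (vcons x y)).
Proof.
move=> bg; rewrite /gaussian_integral [in LHS]/Rintegral.
have bg' : bmeas (fun z : T * n.-tuple T => g (vcons z.1 (row_of_tuple z.2))).
  case: bg => mg [B gB]; split; last first.
    by exists B => z; rewrite -row_of_tcons; exact: gB.
  rewrite (_ : (fun _ => _) = (g \o @row_of_tuple R n.+1) \o @tcons R n).
    by apply: measurableT_comp => //; exact: measurable_tcons.
  by apply/funext => z /=; rewrite row_of_tcons.
have ig := bmeas_integrable (normal_prob (0 : R) 1 \x gaussian R n)%E bg'.
rewrite integral_distribution/=; last 2 first.
- by apply/measurable_EFinP; case: bg.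
- rewrite (_ : _ \o _ = EFin \o (fun z : T * n.-tuple T =>
    g (vcons z.1 (row_of_tuple z.2))))//.
  by apply/funext => z /=; rewrite row_of_tcons.
congr fine.
transitivity (\int[normal_prob 0 1 \x gaussian R n]_z
   (g (vcons z.1 (row_of_tuple z.2)))%:E)%E.
  by apply: eq_integral => z _ /=; rewrite row_of_tcons.
rewrite -(integral12_prod_meas1 ig); apply: eq_integral => x _.
by rewrite EFin_Rintegral//; exact: (bmeas_section bg').
Qed.

End gaussian_cons.

Section gaussian_integral.
Context {R : realType} {n : nat}.
Implicit Types g h : 'rV[R]_n -> R.
Local Notation E := (@gaussian_integral R n).

Lemma gbmeas_cst r : gbmeas (fun _ : 'rV[R]_n => r).
Proof. exact: bmeas_cst. Qed.

Lemma gbmeasD g h : gbmeas g -> gbmeas h -> gbmeas (fun x => g x + h x).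
Proof. exact: bmeasD. Qed.

Lemma gbmeasB g h : gbmeas g -> gbmeas h -> gbmeas (fun x => g x - h x).
Proof. exact: bmeasB. Qed.

Lemma gbmeasM g h : gbmeas g -> gbmeas h -> gbmeas (fun x => g x * h x).
Proof. exact: bmeasM. Qed.

Lemma gbmeasZ r g : gbmeas g -> gbmeas (fun x => r * g x).
Proof. exact: bmeasZ. Qed.

Lemma gbmeasX k g : gbmeas g -> gbmeas (fun x => g x ^+ k).
Proof. exact: bmeasX. Qed.

Lemma gaussian_integral_cst r : E (fun _ => r) = r.
Proof. exact: Rintegral_probability_cst. Qed.

Lemma gaussian_integralD g h : gbmeas g -> gbmeas h ->
  E (fun x => g x + h x) = E g + E h.
Proof. by move=> bg bh; apply: RintegralD => //; exact: bmeas_integrable. Qed.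

Lemma gaussian_integralB g h : gbmeas g -> gbmeas h ->
  E (fun x => g x - h x) = E g - E h.
Proof. by move=> bg bh; apply: RintegralB => //; exact: bmeas_integrable. Qed.

Lemma gaussian_integralZ r g : gbmeas g -> E (fun x => r * g x) = r * E g.
Proof. by move=> bg; apply: RintegralZl => //; exact: bmeas_integrable. Qed.

Lemma le_gaussian_integral g h : gbmeas g -> gbmeas h ->
  (forall x, g x <= h x) -> E g <= E h.
Proof.
by move=> bg bh gh; apply: le_Rintegral => //; exact: bmeas_integrable.
Qed.

Lemma gaussian_integral_ge0 g : (forall x, 0 <= g x) -> 0 <= E g.
Proof. by move=> g0; apply: Rintegral_ge0. Qed.

Lemma gaussian_integral_itv g a b : gbmeas g -> (forall x, a <= g x <= b) ->
  a <= E g <= b.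
Proof.
move=> bg gab; rewrite -[X in X <= _](gaussian_integral_cst a).
rewrite -[X in _ && (_ <= X)](gaussian_integral_cst b).
apply/andP; split; apply: le_gaussian_integral; try exact: gbmeas_cst;
  by move=> // x; have /andP[] := gab x.
Qed.

Lemma dist_gaussian_integral g h e : gbmeas g -> gbmeas h ->
  (forall x, `|g x - h x| <= e) -> `|E g - E h| <= e.
Proof.
move=> bg bh gh; rewrite -gaussian_integralB// ler_norml.
apply: gaussian_integral_itv => [|x]; first exact: gbmeasB.
by rewrite -ler_norml.
Qed.

Lemma lip1_gbmeas L g : 0 <= L -> lip1 L g -> (exists B, forall x, `|g x| <= B) ->
  gbmeas g.
Proof.
move=> L0 Lg [B gB]; split; last by exists B => y; exact: gB.
by apply: (lip1_measurable L0 _ Lg) => i; exact: measurable_row_of_tuple.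
Qed.

End gaussian_integral.

Section gaussian_stable.
Context {R : realType}.
Local Notation T := (measurableTypeR R).
Local Notation E := (@gaussian_integral R _).

Lemma lip_continuous (h : R -> R) L : 0 <= L ->
  (forall x y, `|h x - h y| <= L * `|x - y|) -> continuous h.
Proof.
move=> L0 hL x; apply/cvgrPdist_le => /= e e0.
have L1 : 0 < L + 1 by rewrite ltr_wpDl.
have : \forall y \near x, `|x - y| <= e / (L + 1).
  have /cvgrPdist_le := @cvg_id _ (nbhs x); apply.
  by rewrite divr_gt0.
apply: filterS => y xy; apply: le_trans (hL _ _) _.
apply: (@le_trans _ _ ((L + 1) * `|x - y|)).
  by rewrite ler_wpM2r// lerDl.
by rewrite mulrC -ler_pdivlMr.
Qed.

Lemma gaussian_stable n (h : 'rV[R]_n -> R) (L B a b c : R) :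
  0 <= L -> lip1 L h -> (forall x, `|h x| <= B) ->
  0 <= a -> 0 < b -> 0 < c -> c ^+ 2 = a ^+ 2 + b ^+ 2 ->
  E (fun x => E (fun y => h (a *: x + b *: y))) = E (fun z => h (c *: z)).
Proof.
move=> L0; elim: n h => [|n IH] h hL hB a0 b0 c0 cE.
  have h0 x : h x = h 0 by congr h; rewrite thinmx0.
  transitivity (h 0); last first.
    rewrite (_ : (fun z => _) = fun=> h 0) ?gaussian_integral_cst//.
    by apply/funext => z; rewrite h0.
  rewrite (_ : (fun x => _) = fun=> h 0) ?gaussian_integral_cst//.
  apply/funext => z; rewrite (_ : (fun x => _) = fun=> h 0).
    by rewrite gaussian_integral_cst.
  by apply/funext => y; rewrite h0.
have meas d (S : measurableType d) (X : S -> 'rV[R]_n.+1) :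
    (forall i, measurable_fun [set: S] (fun t => X t 0 i)) ->
    bmeas (fun t => h (X t)).
  by move=> mX; split; [exact: (lip1_measurable L0 mX hL)|exists B].
have mrow d (S : measurableType d) m (Y : S -> m.-tuple T) :
    measurable_fun [set: S] Y ->
    forall i, measurable_fun [set: S] (fun t => row_of_tuple (Y t) 0 i).
  by move=> mY i; exact: (measurableT_comp (measurable_row_of_tuple i) mY).
have mlin d (S : measurableType d) m (X Y : S -> 'rV[R]_m) :
    (forall i, measurable_fun [set: S] (fun t => X t 0 i)) ->
    (forall i, measurable_fun [set: S] (fun t => Y t 0 i)) ->
    (forall i, measurable_fun [set: S] (fun t => (a *: X t + b *: Y t) 0 i)).
  move=> mX mY i.
  rewrite (_ : (fun t => _) = fun t => a * X t 0 i + b * Y t 0 i).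
    by apply: measurable_funD; exact: measurable_funM.
  by apply/funext => t; rewrite !mxE.
have mscale d (S : measurableType d) m (X : S -> 'rV[R]_m) :
    (forall i, measurable_fun [set: S] (fun t => X t 0 i)) ->
    (forall i, measurable_fun [set: S] (fun t => (c *: X t) 0 i)).
  move=> mX i; rewrite (_ : (fun t => _) = fun t => c * X t 0 i).
    exact: measurable_funM.
  by apply/funext => t; rewrite !mxE.
rewrite gaussian_integral_cons; last first.
  apply: (bmeas_Rintegral (gaussian R n.+1) (gaussian R n.+1)
    (F := fun z => h (a *: row_of_tuple z.1 + b *: row_of_tuple z.2))).
  by apply: meas; apply: mlin; exact: mrow.
transitivity (\int[normal_prob 0 1]_x1 \int[normal_prob 0 1]_x2
    E (fun y => h (vcons (a * x1 + b * x2) (c *: y)))).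
  apply: eq_Rintegral => x1 _.
  transitivity (\int[gaussian R n]_y1 \int[normal_prob 0 1]_x2
      E (fun y2 => h (vcons (a * x1 + b * x2) (a *: row_of_tuple y1 + b *: y2)))).
    apply: eq_Rintegral => y1 _ /=.
    rewrite gaussian_integral_cons; last first.
      apply: meas => i.
      pose z := a *: vcons x1 (row_of_tuple y1).
      rewrite (_ : (fun t => _) = fun t => z 0 i + b * row_of_tuple t 0 i).
        apply: measurable_funD => //; apply: measurable_funM => //.
        exact: measurable_row_of_tuple.
      by apply/funext => t; rewrite !mxE.
    apply: eq_Rintegral => x2 _; congr gaussian_integral; apply/funext => y2.
    by rewrite !vconsZ vconsD.
  rewrite (Rintegral_Fubini (gaussian R n) (normal_prob 0 1)
    (F := fun z => E (fun y2 =>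
      h (vcons (a * x1 + b * z.2) (a *: row_of_tuple z.1 + b *: y2))))).
    apply: eq_Rintegral => x2 _ /=.
    apply: (IH (fun y => h (vcons (a * x1 + b * x2) y))) => //.
    move=> y y'; apply: le_trans (hL _ _) _.
    by rewrite vconsN vconsD norm1_vcons subrr normr0 add0r.
  apply: (bmeas_Rintegral (gaussian R n \x normal_prob 0 1)%E (gaussian R n)
    (F := fun z => h (vcons (a * x1 + b * z.1.2)
      (a *: row_of_tuple z.1.1 + b *: row_of_tuple z.2)))).
  apply: meas; apply: measurable_vcons.
    apply: measurable_funD => //; apply: measurable_funM => //.
    exact: (measurableT_comp measurable_snd measurable_fst).
  apply: mlin; apply: mrow => //.
  exact: (measurableT_comp measurable_fst measurable_fst).
rewrite (normal_prob_stable
   (h := fun w => E (fun y => h (vcons w (c *: y)))) (c := c)) //; first last.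
- exists B => w; rewrite ler_norml; apply: gaussian_integral_itv => [|y].
    apply: meas; apply: measurable_vcons => //; apply: mscale.
    exact: measurable_row_of_tuple.
  by rewrite -ler_norml.
- apply: (lip_continuous L0) => w w'; apply: dist_gaussian_integral.
  + apply: meas; apply: measurable_vcons => //; apply: mscale.
    exact: measurable_row_of_tuple.
  + apply: meas; apply: measurable_vcons => //; apply: mscale.
    exact: measurable_row_of_tuple.
  + move=> y; apply: le_trans (hL _ _) _.
    rewrite vconsN vconsD norm1_vcons subrr.
    by rewrite [norm1 _]big1 ?addr0// => i _; rewrite mxE normr0.
rewrite [RHS]gaussian_integral_cons; last first.
  by apply: meas; apply: mscale; exact: measurable_row_of_tuple.
apply: eq_Rintegral => z _; congr gaussian_integral; apply/funext => y.
by rewrite vconsZ.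
Qed.

End gaussian_stable.

Section moment.
Context {R : realType}.
Local Notation mu := (@lebesgue_measure R).
Local Notation T := (measurableTypeR R).

Lemma normal_prob_moment4 : (\int[normal_prob (0 : R) 1]_x (`|x| ^+ 4)%:E < +oo)%E.
Proof.
have m4 : measurable_fun [set: T] (fun x : T => `|x| ^+ 4).
  by apply: measurable_funX; exact: normr_measurable.
rewrite ge0_integral_normal_prob; last 2 first.
- exact/measurable_EFinP.
- by move=> x; rewrite lee_fin exprn_ge0.
pose s : R := Num.sqrt 2.
have s0 : 0 < s by rewrite sqrtr_gt0.
have s2 : s ^+ 2 = 2 by rewrite sqr_sqrtr.
pose K := 32 * normal_peak 1 / normal_peak s.
have K0 : 0 <= K.
  by rewrite divr_ge0 ?mulr_ge0 ?normal_peak_ge0.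
apply: (@le_lt_trans _ _ (\int[mu]_x (K * normal_pdf 0 s x)%:E)%E).
  apply: ge0_le_integral => //.
  - by move=> x _; rewrite -EFinM lee_fin mulr_ge0 ?exprn_ge0 ?normal_pdf_ge0.
  - apply/measurable_EFinP; apply: measurable_funM => //.
    exact: measurable_normal_pdf.
  - apply/measurable_EFinP; apply: measurable_funM => //.
    exact: measurable_normal_pdf.
  - move=> x _; rewrite -EFinM lee_fin.
    rewrite /K /normal_pdf (gt_eqF s0) (gt_eqF ltr01).
    rewrite [leRHS]mulrA divfK ?gt_eqF ?normal_peak_gt0 ?gt_eqF//.
    rewrite mulrCA [X in _ <= X * _]mulrC -[leRHS]mulrA ler_wpM2l ?normal_peak_ge0//.
    rewrite /normal_fun !subr0 expr1n s2 mulr2n mulNr [- x ^+ 2 / _]mulNr.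
    set y := x ^+ 2 / (2 *+ 2).
    have -> : `|x| ^+ 4 = 16 * y ^+ 2.
      rewrite -[4%N]/(2 * 2)%N exprM real_normK ?num_real// /y mulr2n.
      by field.
    have -> : x ^+ 2 / (1 + 1) = y + y by rewrite /y mulr2n; field.
    have y0 : 0 <= y by rewrite divr_ge0// sqr_ge0.
    rewrite opprD expRD mulrA ler_pM2r ?expR_gt0// expRN ler_pdivrMr ?expR_gt0//.
    have := @expR_ge1Dxn _ y 1 y0; rewrite (_ : 2`!%:R = 2 :> R)//; lra.
under eq_integral do rewrite EFinM.
rewrite ge0_integralZl//.
- by rewrite integral_normal_pdf mule1 ltry.
- by apply/measurable_EFinP; exact: measurable_normal_pdf.
- by move=> x _; rewrite lee_fin normal_pdf_ge0.
Qed.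

Lemma measurable_norm1_row n :
  measurable_fun [set: n.-tuple T] (fun y => norm1 (row_of_tuple y)).
Proof.
apply: measurable_sum => i; apply: measurableT_comp => //.
exact: measurable_row_of_tuple.
Qed.

Lemma gaussian_norm1_moment4 n :
  (\int[gaussian R n]_y (norm1 (row_of_tuple y) ^+ 4)%:E < +oo)%E.
Proof.
elim: n => [|n IH].
  rewrite (_ : (fun y => _) = cst 0%E) ?integral0 ?ltry//.
  by apply/funext => y; rewrite /norm1 big_ord0 expr0n.
have m4 : measurable_fun [set: T] (fun x : T => `|x| ^+ 4).
  by apply: measurable_funX; exact: normr_measurable.
have mn4 k : measurable_fun [set: k.-tuple T] (fun y => norm1 (row_of_tuple y) ^+ 4).
  by apply: measurable_funX; exact: measurable_norm1_row.
rewrite /= ge0_integral_distribution/=; last 2 first.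
- by apply/measurable_EFinP; exact: mn4.
- by move=> y; rewrite lee_fin exprn_ge0// norm1_ge0.
pose F (z : T * n.-tuple T) := (8%:E * ((`|z.1| ^+ 4)%:E +
  (norm1 (row_of_tuple z.2) ^+ 4)%:E))%E.
have mF : measurable_fun setT F.
  apply: emeasurable_funM => //; apply: emeasurable_funD.
    by apply/measurable_EFinP; exact: (measurableT_comp m4 measurable_fst).
  by apply/measurable_EFinP; exact: (measurableT_comp (mn4 n) measurable_snd).
have F0 z : (0 <= F z)%E.
  by rewrite mule_ge0// adde_ge0// lee_fin exprn_ge0// norm1_ge0.
apply: (@le_lt_trans _ _ (\int[normal_prob 0 1 \x gaussian R n]_z F z)%E).
  apply: ge0_le_integral => //.
  - by move=> z _; rewrite lee_fin exprn_ge0// norm1_ge0.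
  - apply/measurable_EFinP.
    by apply: (measurableT_comp (mn4 n.+1)); exact: measurable_tcons.
  - move=> z _; rewrite /F -EFinD -EFinM lee_fin row_of_tcons norm1_vcons.
    move: (normr_ge0 z.1) (norm1_ge0 (row_of_tuple z.2)).
    set a := `|_|; set b := norm1 _ => a0 b0.
    have sq (u v : R) : (u + v) ^+ 2 <= 2 * (u ^+ 2 + v ^+ 2).
      by rewrite -subr_ge0 (_ : _ - _ = (u - v) ^+ 2) ?sqr_ge0//; ring.
    rewrite -[4%N]/(2 * 2)%N !exprM.
    apply: (@le_trans _ _ ((2 * (a ^+ 2 + b ^+ 2)) ^+ 2)).
      by rewrite ler_pXn2r ?nnegrE ?sqr_ge0 ?sq// mulr_ge0// addr_ge0// sqr_ge0.
    have := sq (a ^+ 2) (b ^+ 2); rewrite exprMn; lra.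
rewrite fubini_tonelli1//.
have [M4 M4E] : exists r : R, (\int[gaussian R n]_y (norm1 (row_of_tuple y) ^+ 4)%:E)%E = r%:E.
  exists (fine (\int[gaussian R n]_y (norm1 (row_of_tuple y) ^+ 4)%:E)%E).
  rewrite fineK// ge0_fin_numE//; apply: integral_ge0 => y _.
  by rewrite lee_fin exprn_ge0// norm1_ge0.
rewrite (_ : fubini_F _ _ = fun x : T => 8%:E * ((`|x| ^+ 4)%:E + M4%:E))%E; last first.
  apply/funext => x; rewrite /fubini_F /F/= ge0_integralZl//.
  - rewrite ge0_integralD//.
    + by rewrite (integral_probability_cst (gaussian R n)) M4E.
    + by move=> y _; rewrite lee_fin exprn_ge0// norm1_ge0.
    + by apply/measurable_EFinP; exact: mn4.
  - by apply: emeasurable_funD => //; apply/measurable_EFinP; exact: mn4.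
  - by move=> y _; rewrite adde_ge0// lee_fin exprn_ge0// norm1_ge0.
have M40 : 0 <= M4.
  rewrite -lee_fin -M4E; apply: integral_ge0 => y _.
  by rewrite lee_fin exprn_ge0// norm1_ge0.
rewrite ge0_integralZl//.
- rewrite ge0_integralD//.
  + rewrite (integral_probability_cst (normal_prob 0 1)).
    rewrite lte_mul_pinfty// lte_add_pinfty ?ltry//; exact: normal_prob_moment4.
  + by apply/measurable_EFinP; exact: m4.
- by apply: emeasurable_funD => //; apply/measurable_EFinP; exact: m4.
- by move=> y _; rewrite adde_ge0// lee_fin exprn_ge0.
Qed.

Lemma gaussian_integral_exp4 n : exists2 K : R, 0 <= K &
  forall (g : 'rV[R]_n -> R) r, gbmeas g -> 0 <= r ->
  (forall y, `|g y| <= r * norm1 y) ->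
  gaussian_integral (fun y => g y ^+ 4) <= K * r ^+ 4.
Proof.
have M0 : (0 <= \int[gaussian R n]_y (norm1 (row_of_tuple y) ^+ 4)%:E)%E.
  by apply: integral_ge0 => y _; rewrite lee_fin exprn_ge0// norm1_ge0.
exists (fine (\int[gaussian R n]_y (norm1 (row_of_tuple y) ^+ 4)%:E)%E).
  exact: fine_ge0.
move=> g r bg r0 gr.
have bg4 : gbmeas (fun y => g y ^+ 4) by exact: gbmeasX.
have mn4 : measurable_fun [set: n.-tuple T] (fun y => norm1 (row_of_tuple y) ^+ 4).
  by apply: measurable_funX; exact: measurable_norm1_row.
rewrite -lee_fin EFin_Rintegral; last exact: bg4.
rewrite EFinM fineK ?ge0_fin_numE ?gaussian_norm1_moment4//.
rewrite -ge0_integralZr; first last.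
- by rewrite lee_fin exprn_ge0.
- by move=> y _; rewrite lee_fin exprn_ge0// norm1_ge0.
- by apply/measurable_EFinP; exact: mn4.
- exact: measurableT.
apply: ge0_le_integral => //.
- by move=> y _; rewrite lee_fin -[4%N]/(2 * 2)%N exprM sqr_ge0.
- by apply/measurable_EFinP; case: bg4.
- by apply/measurable_EFinP; exact: measurable_funM.
- move=> y _; rewrite -EFinM lee_fin mulrC -exprMn.
  rewrite -[leLHS]ger0_norm; last by rewrite -[4%N]/(2 * 2)%N exprM sqr_ge0.
  by rewrite normrX ler_pXn2r ?nnegrE// mulr_ge0// norm1_ge0.
Qed.

End moment.

(** * The heat semigroup *)

Section heat.
Context {R : realType} {n : nat}.
Local Notation V := 'rV[R]_n.
Local Notation E := (@gaussian_integral R n).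
Implicit Types (g h k : V -> R) (x z : V) (s t : R).

Definition bl g := exists L B, [/\ 0 <= L, lip1 L g & forall x, `|g x| <= B].

Lemma bl_gbmeas g : bl g -> gbmeas g.
Proof. by move=> [L [B [L0 gL gB]]]; apply: (lip1_gbmeas L0 gL); exists B. Qed.

Lemma bl_shift g x (r : R) : bl g -> bl (fun y => g (x + r *: y)).
Proof.
move=> [L [B [L0 gL gB]]]; exists (L * `|r|), B; split=> // [|y z].
  exact: mulr_ge0.
apply: le_trans (gL _ _) _.
by rewrite -mulrA ler_wpM2l// opprD addrACA subrr add0r -scalerBr norm1Z.
Qed.

Lemma blD g h : bl g -> bl h -> bl (fun x => g x + h x).
Proof.
move=> [L [B [L0 gL gB]]] [K [C [K0 hK hC]]]; exists (L + K), (B + C); split.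
- exact: addr_ge0.
- move=> x y; rewrite opprD addrACA mulrDl.
  by apply: le_trans (ler_normD _ _) _; exact: lerD.
- by move=> x; apply: le_trans (ler_normD _ _) _; exact: lerD.
Qed.

Lemma blM g h : bl g -> bl h -> bl (fun x => g x * h x).
Proof.
move=> [L [B [L0 gL gB]]] [K [C [K0 hK hC]]].
have B0 : 0 <= B by exact: le_trans (gB 0).
have C0 : 0 <= C by exact: le_trans (hC 0).
exists (L * C + B * K), (B * C); split.
- by rewrite addr_ge0// mulr_ge0.
- move=> x y.
  have -> : g x * h x - g y * h y = (g x - g y) * h x + g y * (h x - h y) by ring.
  apply: le_trans (ler_normD _ _) _; rewrite !normrM mulrDl; apply: lerD.
    by rewrite mulrAC; exact: ler_pM.
  by rewrite -mulrA; exact: ler_pM.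
- by move=> x; rewrite normrM; exact: ler_pM.
Qed.

Lemma bl_cst (r : R) : bl (fun=> r).
Proof.
exists 0, `|r|; split=> // x y.
by rewrite subrr normr0 mul0r.
Qed.

Lemma blZ (r : R) g : bl g -> bl (fun x => r * g x).
Proof. by move=> bg; apply: (blM (bl_cst r)). Qed.

Lemma blB g h : bl g -> bl h -> bl (fun x => g x - h x).
Proof.
move=> bg bh; rewrite (_ : (fun _ => _) = fun x => g x + (fun=> -1) x * h x).
  by apply: blD => //; apply: blM => //; exact: bl_cst.
by apply/funext => x; rewrite mulN1r.
Qed.

Lemma bl_sqr g : bl g -> bl (fun x => g x ^+ 2).
Proof. by move=> bg; exact: blM. Qed.

Definition heat s g x : R := E (fun y => g (x + Num.sqrt s *: y)).

Lemma gbmeas_shift g x (r : R) : bl g -> gbmeas (fun y => g (x + r *: y)).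
Proof. by move=> bg; exact/bl_gbmeas/bl_shift. Qed.

Lemma heat0 g x : heat 0 g x = g x.
Proof.
rewrite /heat -[RHS](@gaussian_integral_cst R n); congr gaussian_integral.
by apply/funext => y; rewrite sqrtr0 scale0r addr0.
Qed.

Lemma lip1_heat L s g : 0 <= L -> lip1 L g -> bl g -> lip1 L (heat s g).
Proof.
move=> L0 gL bg x x'; apply: dist_gaussian_integral => [||y];
  [exact: gbmeas_shift..|].
by apply: le_trans (gL _ _) _; rewrite opprD addrACA subrr addr0.
Qed.

Lemma heat_itv (a b : R) s g x : bl g -> (forall z, a <= g z <= b) ->
  a <= heat s g x <= b.
Proof. by move=> bg gab; apply: gaussian_integral_itv => //; exact: gbmeas_shift. Qed.

Lemma bl_heat s g : bl g -> bl (heat s g).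
Proof.
move=> bg; case: (bg) => [L [B [L0 gL gB]]]; exists L, B; split=> //.
  exact: lip1_heat.
move=> x; rewrite ler_norml; apply: heat_itv => // z.
by rewrite -ler_norml.
Qed.

Lemma heatD s g h x : bl g -> bl h ->
  heat s (fun z => g z + h z) x = heat s g x + heat s h x.
Proof. by move=> bg bh; apply: gaussian_integralD; exact: gbmeas_shift. Qed.

Lemma heatB s g h x : bl g -> bl h ->
  heat s (fun z => g z - h z) x = heat s g x - heat s h x.
Proof. by move=> bg bh; apply: gaussian_integralB; exact: gbmeas_shift. Qed.

Lemma heatZ (r : R) s g x : bl g -> heat s (fun z => r * g z) x = r * heat s g x.
Proof. by move=> bg; apply: gaussian_integralZ; exact: gbmeas_shift. Qed.

Lemma heat_cst (r : R) s x : heat s (fun=> r) x = r.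
Proof. exact: gaussian_integral_cst. Qed.

Lemma le_heat s g h x : bl g -> bl h -> (forall z, g z <= h z) ->
  heat s g x <= heat s h x.
Proof.
by move=> bg bh gh; apply: le_gaussian_integral => //; exact: gbmeas_shift.
Qed.

Lemma heat_heat s t g x : 0 <= s -> 0 <= t -> bl g ->
  heat s (heat t g) x = heat (s + t) g x.
Proof.
move=> s0; rewrite le_eqVlt => /predU1P[<- _|t0 [L [B [L0 gL gB]]]].
  by rewrite addr0; congr heat; apply/funext => z; rewrite heat0.
transitivity (E (fun y => E (fun z => g (x + (Num.sqrt s *: y + Num.sqrt t *: z))))).
  congr gaussian_integral; apply/funext => y; congr gaussian_integral.
  by apply/funext => z; rewrite addrA.
apply: (@gaussian_stable _ _ (fun w => g (x + w)) L B) => //.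
- by move=> y z; apply: le_trans (gL _ _) _; rewrite opprD addrACA subrr add0r.
- by rewrite sqrtr_gt0.
- by rewrite sqrtr_gt0 ltr_wpDl.
- by rewrite !sqr_sqrtr ?addr_ge0// ltW.
Qed.

Lemma gaussian_Fubini h g x (a b : R) : bl h -> bl g ->
  E (fun y => E (fun z => h z * g (x + a *: y + b *: z))) =
  E (fun z => h z * E (fun y => g (x + a *: y + b *: z))).
Proof.
move=> bh bg; case: (bg) => [L [B [L0 gL gB]]].
have mrow d (S : measurableType d) (Y : S -> n.-tuple (measurableTypeR R)) :
    measurable_fun [set: S] Y ->
    forall i, measurable_fun [set: S] (fun w => row_of_tuple (Y w) 0 i).
  by move=> mY i; exact: (measurableT_comp (measurable_row_of_tuple i) mY).
rewrite /gaussian_integral.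
rewrite (Rintegral_Fubini (gaussian R n) (gaussian R n)
  (F := fun w => h (row_of_tuple w.2) *
     g (x + a *: row_of_tuple w.1 + b *: row_of_tuple w.2))).
  apply: eq_Rintegral => z _ /=; rewrite RintegralZl//.
  apply: (@bmeas_integrable _ _ _ _ (fun y => g (x + a *: row_of_tuple y +
    b *: row_of_tuple z))).
  have := gbmeas_shift (x + b *: row_of_tuple z) a bg.
  rewrite /gbmeas (_ : _ \o _ = fun y => g (x + a *: row_of_tuple y +
    b *: row_of_tuple z))//.
  by apply/funext => y /=; rewrite addrAC.
apply: bmeasM.
  have [mh [C hC]] := bl_gbmeas bh; split; last by exists C => w; exact: hC.
  exact: (measurableT_comp mh measurable_snd).
split; last by exists B.
apply: (lip1_measurable L0 _ gL) => i.
rewrite (_ : (fun w => _) = fun w => x 0 i + a * row_of_tuple w.1 0 i +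
  b * row_of_tuple w.2 0 i); last by apply/funext => w; rewrite !mxE.
apply: measurable_funD; last by apply: measurable_funM => //; exact: mrow.
apply: measurable_funD => //; apply: measurable_funM => //; exact: mrow.
Qed.

Lemma gaussian_integral_sqr_le g : gbmeas g -> E g ^+ 2 <= E (fun y => g y ^+ 2).
Proof.
move=> bg; set m := E g.
have : 0 <= E (fun y => (g y - m) ^+ 2).
  by apply: gaussian_integral_ge0 => y; rewrite sqr_ge0.
rewrite (_ : (fun y => (g y - m) ^+ 2) =
  fun y => g y ^+ 2 - (2 * m * g y - m ^+ 2)); last first.
  by apply/funext => y; ring.
have bg2 := gbmeasX 2 bg.
have b1 : gbmeas (fun y => 2 * m * g y) by exact: gbmeasZ.
have b2 : gbmeas (fun _ : V => m ^+ 2) by exact: gbmeas_cst.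
have b3 := gbmeasB b1 b2.
rewrite gaussian_integralB// gaussian_integralB// gaussian_integralZ//.
by rewrite gaussian_integral_cst -/m; lra.
Qed.

Definition heat_var s g x : R :=
  E (fun y => (g (x + Num.sqrt s *: y) - heat s g x) ^+ 2).

Lemma heat_var_ge0 s g x : 0 <= heat_var s g x.
Proof. by apply: gaussian_integral_ge0 => y; rewrite sqr_ge0. Qed.

Lemma heat_varE s g x : bl g ->
  heat_var s g x = heat s (fun z => g z ^+ 2) x - heat s g x ^+ 2.
Proof.
move=> bg; rewrite /heat_var; set m := heat s g x.
rewrite (_ : (fun y => _) = fun y => g (x + Num.sqrt s *: y) ^+ 2 -
    (2 * m * g (x + Num.sqrt s *: y) - m ^+ 2)); last first.
  by apply/funext => y; ring.
have bg1 := gbmeas_shift x (Num.sqrt s) bg.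
have bg2 := gbmeasX 2 bg1.
have b1 : gbmeas (fun y => 2 * m * g (x + Num.sqrt s *: y)) by exact: gbmeasZ.
have b2 : gbmeas (fun _ : V => m ^+ 2) by exact: gbmeas_cst.
have b3 := gbmeasB b1 b2.
rewrite gaussian_integralB// gaussian_integralB// gaussian_integralZ//.
by rewrite gaussian_integral_cst -/(heat s g x) -/m /heat; ring.
Qed.

Lemma heat_var0 g x : heat_var 0 g x = 0.
Proof.
rewrite /heat_var (_ : (fun y => _) = fun=> 0) ?gaussian_integral_cst//.
by apply/funext => y; rewrite heat0 sqrtr0 scale0r addr0 subrr expr0n.
Qed.

Lemma bl_heat_var s g : bl g -> bl (heat_var s g).
Proof.
move=> bg; rewrite (_ : heat_var s g =
  fun x => heat s (fun z => g z ^+ 2) x - heat s g x ^+ 2).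
  by apply: blB; [apply: bl_heat|apply: bl_sqr; apply: bl_heat] => //; exact: bl_sqr.
by apply/funext => x; exact: heat_varE.
Qed.

Lemma heat_var_total s t g x : 0 <= s -> 0 <= t -> bl g ->
  heat_var (s + t) g x = heat s (heat_var t g) x + heat_var s (heat t g) x.
Proof.
move=> s0 t0 bg; have bg2 := bl_sqr bg.
have bh := bl_heat t bg.
rewrite !heat_varE// (_ : heat_var t g =
  fun x => heat t (fun z => g z ^+ 2) x - heat t g x ^+ 2); last first.
  by apply/funext => z; exact: heat_varE.
rewrite heatB//; [|exact: bl_heat|exact: bl_sqr].
by rewrite !heat_heat//; ring.
Qed.

(* With [m = heat t k], [theta] proportional to the centred [heat s k] and
   any [rho > 0], [heat_var t k / rho >= 2 E (theta k) - rho E theta^2]; this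
   bound is affine in [rho], hence in [m] after bounding [rho] by an affine
   function of [m], so that averaging it is an equality. *)
Lemma heat_le_mean_var s t k x (q rho : V -> R) (beta r p e : R) :
  0 <= s -> 0 <= t -> bl k -> bl q -> 0 <= beta -> 0 < r ->
  (forall z, 0 < rho z <= r + p * (heat t k z - heat (s + t) k x)) ->
  (forall z, q z <= heat t k z - beta * (heat_var t k z / rho z) + e) ->
  heat s q x <= heat (s + t) k x - beta * (heat_var t (heat s k) x / r) + e.
Proof.
move=> s0 t0 bk bq beta0 r0 hrho hq.
set mb := heat (s + t) k x in hrho *.
set W := heat_var t (heat s k) x.
pose th y := r^-1 * (heat s k (x + Num.sqrt t *: y) - mb).
have bhk : bl (fun y => heat s k (x + Num.sqrt t *: y)).
  exact/bl_shift/bl_heat.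
have bth : bl th by exact: (blZ _ (blB bhk (bl_cst mb))).
have mbE : heat t (heat s k) x = mb by rewrite (heat_heat x t0 s0 bk) [t + s]addrC.
have Eth : E th = 0.
  rewrite gaussian_integralZ; last first.
    by apply: gbmeasB; [exact: bl_gbmeas|exact: gbmeas_cst].
  rewrite gaussian_integralB ?gaussian_integral_cst; [|exact: bl_gbmeas|exact: gbmeas_cst].
  by rewrite -/(heat t _ _) mbE subrr mulr0.
have Eth2 : E (fun y => th y ^+ 2) = W / r ^+ 2.
  rewrite (_ : (fun y => _) = fun y => (r ^+ 2)^-1 *
     (heat s k (x + Num.sqrt t *: y) - mb) ^+ 2); last first.
    by apply/funext => y; rewrite /th exprMn exprVn.
  rewrite gaussian_integralZ; first by rewrite mulrC /W /heat_var mbE.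
  by apply: gbmeasX; apply: gbmeasB; [exact: bl_gbmeas|exact: gbmeas_cst].
pose A z := E (fun y => th y * k (z + Num.sqrt t *: y)).
have key z : 2 * A z - rho z * (W / r ^+ 2) <= heat_var t k z / rho z.
  have /andP[rz _] := hrho z.
  set m := heat t k z.
  have : 0 <= E (fun y => (k (z + Num.sqrt t *: y) - m - rho z * th y) ^+ 2).
    by apply: gaussian_integral_ge0 => y; rewrite sqr_ge0.
  have bkz := gbmeas_shift z (Num.sqrt t) bk.
  have bt := bl_gbmeas bth.
  have b1 : gbmeas (fun y => (k (z + Num.sqrt t *: y) - m) ^+ 2).
    by apply/gbmeasX/gbmeasB => //; exact: gbmeas_cst.
  have b2 : gbmeas (fun y => 2 * rho z * (th y * k (z + Num.sqrt t *: y))).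
    by apply: gbmeasZ; exact: gbmeasM.
  have b3 : gbmeas (fun y => 2 * rho z * m * th y) by exact: gbmeasZ.
  have b4 : gbmeas (fun y => rho z ^+ 2 * th y ^+ 2).
    by apply: gbmeasZ; exact: gbmeasX.
  rewrite (_ : (fun y => _) = fun y => (k (z + Num.sqrt t *: y) - m) ^+ 2 -
      2 * rho z * (th y * k (z + Num.sqrt t *: y)) +
      2 * rho z * m * th y + rho z ^+ 2 * th y ^+ 2); last first.
    by apply/funext => y; ring.
  rewrite gaussian_integralD//; last by apply: gbmeasD => //; exact: gbmeasB.
  rewrite gaussian_integralD//; last exact: gbmeasB.
  rewrite gaussian_integralB// (gaussian_integralZ _ (gbmeasM bt bkz)).
  rewrite (gaussian_integralZ _ bt) (gaussian_integralZ _ (gbmeasX 2 bt)).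
  rewrite -/(heat_var t k z) -/(A z) Eth Eth2 mulr0 addr0 => h.
  rewrite ler_pdivlMr//; move: h; set X := W / _; lra.
have bA : bl A.
  case: (bk) => [L [B [L0 kL kB]]]; case: (bth) => [_ [C [_ _ thC]]].
  have C0 : 0 <= C by exact: le_trans (thC 0).
  have gA z : gbmeas (fun y => th y * k (z + Num.sqrt t *: y)).
    by apply: gbmeasM; [exact: bl_gbmeas|exact: gbmeas_shift].
  exists (C * L), (C * B); split; first exact: mulr_ge0.
    move=> z z'; apply: dist_gaussian_integral => // y.
    rewrite -mulrBr normrM -mulrA; apply: ler_pM => //.
    by apply: le_trans (kL _ _) _; rewrite opprD addrACA subrr addr0.
  move=> z; rewrite ler_norml; apply: gaussian_integral_itv => // y.
  by rewrite -ler_norml normrM; exact: ler_pM.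
have bm : bl (heat t k) by exact: bl_heat.
pose T z := heat t k z - beta * (2 * A z -
   (r + p * (heat t k z - mb)) * (W / r ^+ 2)) + e.
have W0 : 0 <= W / r ^+ 2 by rewrite divr_ge0 ?sqr_ge0// heat_var_ge0.
have qT z : q z <= T z.
  apply: le_trans (hq z) _; rewrite lerD2r lerD2l lerN2 ler_wpM2l//.
  apply: le_trans (key z); rewrite lerD2l lerN2 ler_wpM2r//.
  by have /andP[] := hrho z.
pose w := beta * (W / r ^+ 2).
have TE : T = fun z => ((1 + w * p) * heat t k z - 2 * beta * A z) +
    (e + w * (r - p * mb)).
  by apply/funext => z; rewrite /T /w; ring.
have bl1 : bl (fun z => (1 + w * p) * heat t k z) by exact: blZ.
have bl2 : bl (fun z => 2 * beta * A z) by exact: blZ.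
have bT : bl T by rewrite TE; apply: blD; [exact: blB|exact: bl_cst].
apply: le_trans (le_heat s x bq bT qT) _.
rewrite TE heatD; [|exact: blB|exact: bl_cst].
rewrite heatB// heat_cst (heatZ _ _ _ bm) (heatZ _ _ _ bA) (heat_heat x s0 t0 bk).
rewrite -/mb {1}/heat.
have -> : E (fun y => A (x + Num.sqrt s *: y)) = W / r.
  rewrite /A gaussian_Fubini//.
  have bt := bl_gbmeas bth.
  transitivity (E (fun y => r * th y ^+ 2 + mb * th y)).
    congr gaussian_integral; apply/funext => y.
    transitivity (th y * (heat s k (x + Num.sqrt t *: y))).
      congr (_ * _); rewrite /heat; congr gaussian_integral; apply/funext => z.
      by rewrite addrAC.
    by rewrite /th; field; rewrite gt_eqF.
  have bt2 := gbmeasX 2 bt.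
  rewrite (gaussian_integralD (gbmeasZ r bt2) (gbmeasZ mb bt)).
  rewrite (gaussian_integralZ _ bt2) (gaussian_integralZ _ bt).
  by rewrite Eth Eth2; field; rewrite gt_eqF.
rewrite le_eqVlt; apply/orP; left; apply/eqP; rewrite /w; field.
by rewrite gt_eqF.
Qed.

Lemma heat_var_heat_le s t k x : 0 <= s -> 0 <= t -> bl k ->
  heat_var t (heat s k) x <= heat s (heat_var t k) x.
Proof.
move=> s0 t0 bk.
have bm : bl (heat t k) by exact: bl_heat.
have bv : bl (heat_var t k) by exact: bl_heat_var.
have := @heat_le_mean_var s t k x (fun z => heat t k z - heat_var t k z)
  (fun=> 1) 1 1 0 0 s0 t0 bk (blB bm bv) ler01 ltr01.
rewrite (heatB s x bm bv) (heat_heat x s0 t0 bk) => H.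
have h1 z : 0 < (1 : R) <= 1 + 0 * (heat t k z - heat (s + t) k x).
  by rewrite mul0r addr0 ltr01 lexx.
have h2 z : heat t k z - heat_var t k z <=
    heat t k z - 1 * (heat_var t k z / 1) + 0 by rewrite divr1 mul1r addr0.
by have := H h1 h2; rewrite mul1r divr1 addr0 lerD2l lerN2.
Qed.

End heat.

Section heat_var_contraction.
Context {R : realType} {n : nat}.
Local Notation V := 'rV[R]_n.
Implicit Types (g h k : V -> R) (x z : V) (s t : R).

Lemma convex_seq_chord (S : nat -> R) (N k : nat) : S 0%N = 0 -> (k <= N)%N ->
  (forall j, (j.+1 < N)%N -> S j.+1 - S j <= S j.+2 - S j.+1) ->
  N%:R * S k <= k%:R * S N.
Proof.
move=> S0 kN inc.
have step j : (j < N)%N -> S j <= j%:R * (S j.+1 - S j).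
  elim: j => [_|j IH jN]; first by rewrite S0 mul0r.
  have := inc j jN => h; have := IH (ltnW jN) => h'.
  apply: (@le_trans _ _ (j.+1%:R * (S j.+1 - S j))); last by rewrite ler_wpM2l.
  by rewrite -[j.+1%:R]natr1 mulrDl mul1r; lra.
elim: N kN step {inc} => [|N IH] kN step.
  by move: kN; rewrite leqn0 => /eqP ->; rewrite S0.
move: kN; rewrite leq_eqVlt => /predU1P[->//|]; rewrite ltnS => kN.
have {}IH := IH kN (fun j jN => step j (ltnW jN)).
have [N0|N0] := posnP N.
  by move: kN; rewrite N0 leqn0 => /eqP ->; rewrite S0 mulr0 mul0r.
have NR : 0 < N%:R :> R by rewrite ltr0n.
rewrite -(ler_pM2l NR).
have stepN := step N (ltnSn N).
have -> : N%:R * (N.+1%:R * S k) = N.+1%:R * (N%:R * S k) by ring.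
apply: (@le_trans _ _ (N.+1%:R * (k%:R * S N))); first by rewrite ler_wpM2l.
have -> : N%:R * (k%:R * S N.+1) = k%:R * (N%:R * S N.+1) by ring.
rewrite mulrCA ler_wpM2l// -[N.+1%:R]natr1; lra.
Qed.

Lemma le_heat_var s t d g x : 0 <= s -> 0 <= t -> s + t <= d -> bl g ->
  heat_var s (heat (d - s) g) x <= heat_var (s + t) (heat (d - (s + t)) g) x.
Proof.
move=> s0 t0 std bg.
have d0 : 0 <= d - (s + t) by rewrite subr_ge0.
have bh : bl (heat (d - (s + t)) g) by exact: bl_heat.
rewrite (heat_var_total x s0 t0 bh).
have -> : heat t (heat (d - (s + t)) g) = heat (d - s) g.
  have dE : t + (d - (s + t)) = d - s by ring.
  by apply/funext => z; rewrite (heat_heat z t0 d0 bg) dE.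
rewrite lerDr /heat.
by apply: gaussian_integral_ge0 => y; exact: heat_var_ge0.
Qed.

Lemma heat_var_chord d (N k : nat) g x : 0 <= d -> (0 < N)%N -> (k <= N)%N -> bl g ->
  N%:R * heat_var (k%:R * (d / N%:R)) (heat (d - k%:R * (d / N%:R)) g) x <=
  k%:R * heat_var d g x.
Proof.
move=> d0 N0 kN bg; have NR : 0 < N%:R :> R by rewrite ltr0n.
set tau := d / N%:R.
have tau0 : 0 <= tau by rewrite divr_ge0.
have taud : N%:R * tau = d by rewrite mulrC divfK// gt_eqF.
pose S j := heat_var (j%:R * tau) (heat (d - j%:R * tau) g) x.
have -> : heat_var d g x = S N.
  have h0 : heat 0 g = g by apply/funext => z; exact: heat0.
  by rewrite /S taud subrr h0.
have dj j : (j <= N)%N -> 0 <= d - j%:R * tau.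
  by move=> jN; rewrite -taud -mulrBl mulr_ge0// subr_ge0 ler_nat.
have incE j : (j < N)%N -> S j.+1 - S j =
    heat (j%:R * tau) (heat_var tau (heat (d - j.+1%:R * tau) g)) x.
  move=> jN; rewrite /S -[j.+1%:R]natr1 mulrDl mul1r.
  have h := dj _ jN; rewrite -[j.+1%:R]natr1 mulrDl mul1r in h.
  have bh : bl (heat (d - (j%:R * tau + tau)) g) by exact: bl_heat.
  have jt : 0 <= j%:R * tau by rewrite mulr_ge0.
  rewrite (heat_var_total x jt tau0 bh).
  have -> : heat tau (heat (d - (j%:R * tau + tau)) g) = heat (d - j%:R * tau) g.
    have dE : tau + (d - (j%:R * tau + tau)) = d - j%:R * tau by ring.
    by apply/funext => z; rewrite (heat_heat z tau0 h bg) dE.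
  by rewrite addrK.
apply: (@convex_seq_chord S N k _ kN).
  by rewrite /S mul0r heat_var0.
move=> j jN; rewrite [leLHS](incE _ (ltnW jN)) [leRHS](incE _ jN).
have jt : 0 <= j%:R * tau by rewrite mulr_ge0.
have h2 := dj _ jN.
have bh : bl (heat (d - j.+2%:R * tau) g) by exact: bl_heat.
have bv : bl (heat_var tau (heat (d - j.+2%:R * tau) g)) by exact: bl_heat_var.
have jE : j.+1%:R * tau = j%:R * tau + tau by rewrite -natr1 mulrDl mul1r.
rewrite [X in _ <= heat X _ _]jE -(heat_heat x jt tau0 bv).
apply: le_heat => [||z].
- by apply/bl_heat_var/bl_heat.
- exact: bl_heat.
have -> : heat (d - j.+1%:R * tau) g = heat tau (heat (d - j.+2%:R * tau) g).
  have dE : tau + (d - j.+2%:R * tau) = d - j.+1%:R * tau.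
    by rewrite -[j.+2%:R]natr1; ring.
  by apply/funext => w; rewrite (heat_heat w tau0 h2 bg) dE.
exact: heat_var_heat_le.
Qed.

(* The squared maximal correlation of Brownian motion at times [d / p] and
   [d] is [1 / p]. *)
Lemma heat_var_contraction d p g x : 0 <= d -> 1 <= p -> bl g ->
  p * heat_var (d / p) (heat (d - d / p) g) x <= heat_var d g x.
Proof.
move=> d0; rewrite le_eqVlt => /predU1P[<- bg|p1 bg].
  rewrite divr1 subrr mul1r.
  have h0 : heat 0 g = g by apply/funext => z; exact: heat0.
  by rewrite h0.
have p0 : 0 < p by rewrite (lt_trans ltr01).
set v := heat_var (d / p) _ x; set w := heat_var d g x.
have w0 : 0 <= w by exact: heat_var_ge0.
have main N : (0 < N)%N -> v <= (p^-1 + N%:R^-1) * w.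
  move=> N0; have NR : 0 < N%:R :> R by rewrite ltr0n.
  pose k := (Num.truncn (N%:R / p)).+1.
  have Np0 : 0 <= N%:R / p by rewrite divr_ge0// ltW.
  have /andP[k1 k2] := truncn_itv Np0.
  have kN : (k <= N)%N.
    rewrite /k -(ltr_nat R); apply: le_lt_trans k1 _.
    by rewrite ltr_pdivrMr// ltr_pMr.
  have dN : d / p <= k%:R * (d / N%:R).
    rewrite mulrA ler_pdivlMr// [leLHS]mulrAC -[leLHS]mulrA [leRHS]mulrC.
    by rewrite ler_wpM2l// ltW.
  have := @le_heat_var (d / p) (k%:R * (d / N%:R) - d / p) d g x.
  rewrite subrKC -/v divr_ge0 ?(ltW p0)// subr_ge0 dN => /(_ isT isT) h.
  have kd : k%:R * (d / N%:R) <= d.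
    by rewrite mulrCA ler_piMr// ler_pdivrMr// mul1r ler_nat.
  have {}h := h kd bg; apply: le_trans h _.
  have := heat_var_chord x d0 N0 kN bg; rewrite -/w.
  rewrite mulrC -ler_pdivlMr// => h; apply: le_trans h _.
  rewrite mulrAC ler_wpM2r// ler_pdivrMr// mulrDl mulVf ?gt_eqF//.
  rewrite /k -natr1 lerD2r; apply: le_trans k1 _.
  by rewrite mulrC.
rewrite mulrC -ler_pdivlMr//; apply/ler_addgt0Pr => e e0.
pose N := (Num.truncn (w / e)).+1.
have NR : 0 < N%:R :> R by rewrite ltr0n.
apply: le_trans (main N isT) _.
rewrite mulrDl [p^-1 * w]mulrC lerD2l mulrC ler_pdivrMr// mulrC -ler_pdivrMr//.
by apply/ltW; have /andP[] := truncn_itv (divr_ge0 w0 (ltW e0)).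
Qed.

End heat_var_contraction.

(** * Small-time expansion of nonlinear averages *)

Section central_moments.
Context {R : realType} {n : nat}.
Local Notation V := 'rV[R]_n.
Local Notation E := (@gaussian_integral R n).
Implicit Types (g h k : V -> R) (x z : V) (s t : R).

Lemma expr4_ge0 (r : R) : 0 <= r ^+ 4.
Proof. by rewrite -[4%N]/(2 * 2)%N exprM sqr_ge0. Qed.

Lemma expr4D_le (u v : R) : (u - v) ^+ 4 <= 8 * (u ^+ 4 + v ^+ 4).
Proof.
have sq (a b : R) : (a - b) ^+ 2 <= 2 * (a ^+ 2 + b ^+ 2).
  by rewrite -subr_ge0 (_ : _ - _ = (a + b) ^+ 2) ?sqr_ge0//; ring.
have sq' (a b : R) : (a + b) ^+ 2 <= 2 * (a ^+ 2 + b ^+ 2).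
  by rewrite -subr_ge0 (_ : _ - _ = (a - b) ^+ 2) ?sqr_ge0//; ring.
rewrite -[4%N]/(2 * 2)%N !exprM.
apply: (@le_trans _ _ ((2 * (u ^+ 2 + v ^+ 2)) ^+ 2)).
  by rewrite ler_pXn2r ?nnegrE ?sqr_ge0 ?sq// mulr_ge0// addr_ge0// sqr_ge0.
have := sq' (u ^+ 2) (v ^+ 2); rewrite exprMn; lra.
Qed.

Lemma heat_central_moments : exists2 K : R, 0 <= K & forall L g s x,
  0 <= L -> lip1 L g -> bl g -> 0 <= s ->
  heat_var s g x <= K * L ^+ 2 * s /\
  E (fun y => (g (x + Num.sqrt s *: y) - heat s g x) ^+ 4) <= (K * L ^+ 2 * s) ^+ 2.
Proof.
have [K4 K40 hK4] := gaussian_integral_exp4 (R := R) n.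
exists (4 * (1 + K4)); first by rewrite mulr_ge0// addr_ge0.
move=> L g s x L0 gL bg s0; set c := L * Num.sqrt s.
have c0 : 0 <= c by rewrite mulr_ge0.
have c2 : c ^+ 2 = L ^+ 2 * s by rewrite exprMn sqr_sqrtr.
pose h y := g (x + Num.sqrt s *: y) - g x.
have bs : gbmeas (fun y => g (x + Num.sqrt s *: y)) by exact: gbmeas_shift.
have bh : gbmeas h by apply: gbmeasB => //; exact: gbmeas_cst.
have hc y : `|h y| <= c * norm1 y.
  apply: le_trans (gL _ _) _.
  by rewrite addrAC subrr add0r norm1Z mulrA ger0_norm ?sqrtr_ge0.
have E4 := hK4 h c bh c0 hc.
have mE : heat s g x = g x + E h.
  rewrite gaussian_integralB//; last exact: gbmeas_cst.
  by rewrite gaussian_integral_cst subrKC.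
have hE y : g (x + Num.sqrt s *: y) - heat s g x = h y - E h.
  by rewrite mE /h; ring.
have bh4 := gbmeasX 4 bh.
have e4 : E h ^+ 4 <= E (fun y => h y ^+ 4).
  have h2 := gaussian_integral_sqr_le (gbmeasX 2 bh).
  have h1 := gaussian_integral_sqr_le bh.
  rewrite -[4%N in leLHS]/(2 * 2)%N exprM.
  apply: (@le_trans _ _ (E (fun y => h y ^+ 2) ^+ 2)).
    rewrite ler_pXn2r ?nnegrE ?sqr_ge0//.
    by apply: gaussian_integral_ge0 => y; rewrite sqr_ge0.
  apply: le_trans h2 _; rewrite le_eqVlt; apply/orP; left; apply/eqP.
  by congr gaussian_integral; apply/funext => y; rewrite -exprM.
have W4 : E (fun y => (g (x + Num.sqrt s *: y) - heat s g x) ^+ 4) <=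
    16 * (K4 * c ^+ 4).
  apply: (@le_trans _ _ (E (fun y => 8 * (h y ^+ 4 + E h ^+ 4)))).
    apply: le_gaussian_integral => [||y].
    - by apply/gbmeasX/gbmeasB => //; exact: gbmeas_cst.
    - by apply/gbmeasZ/gbmeasD => //; exact: gbmeas_cst.
    - by rewrite hE expr4D_le.
  have b1 := gbmeasD bh4 (gbmeas_cst (E h ^+ 4)).
  rewrite (gaussian_integralZ _ b1) (gaussian_integralD bh4 (gbmeas_cst _)).
  rewrite gaussian_integral_cst; lra.
have W4' : E (fun y => (g (x + Num.sqrt s *: y) - heat s g x) ^+ 4) <=
    (4 * (1 + K4) * L ^+ 2 * s) ^+ 2.
  apply: le_trans W4 _; rewrite -[_ * L ^+ 2 * s]mulrA -c2 [leRHS]exprMn.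
  rewrite -[in leRHS]exprM mulrA ler_wpM2r//; first exact: expr4_ge0.
  rewrite exprMn; have : 0 <= K4 ^+ 2 by rewrite sqr_ge0.
  rewrite sqrrD; lra.
split=> //.
have v0 : 0 <= heat_var s g x by exact: heat_var_ge0.
have r0 : 0 <= 4 * (1 + K4) * L ^+ 2 * s.
  by rewrite !mulr_ge0 ?sqr_ge0// addr_ge0.
rewrite -(@ler_pXn2r _ 2) ?nnegrE//; apply: le_trans W4'.
have bsm : gbmeas (fun y => (g (x + Num.sqrt s *: y) - heat s g x) ^+ 2).
  by apply/gbmeasX/gbmeasB => //; exact: gbmeas_cst.
apply: le_trans (gaussian_integral_sqr_le bsm) _.
rewrite le_eqVlt; apply/orP; left; apply/eqP.
by congr gaussian_integral; apply/funext => y; rewrite -exprM.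
Qed.

End central_moments.

Section expansion.
Context {R : realType} {n : nat}.
Local Notation V := 'rV[R]_n.
Local Notation E := (@gaussian_integral R n).
Implicit Types (g h : V -> R) (s t : R).

(* [phi' = D] and [phi'' = D * q]. *)
Record second_order (a b : R) (phi D q : R -> R) (k K Q : R) : Prop := {
  so_k_gt0 : 0 < k;
  so_incr : forall x y, a <= x -> x <= y -> y <= b ->
    k * (y - x) <= phi y - phi x <= K * (y - x);
  so_D : forall x, a <= x <= b -> k <= D x <= K;
  so_q : forall x, a <= x <= b -> `|q x| <= Q;
  so_taylor : forall e, 0 < e -> exists2 C, 0 <= C &
    forall x y, a <= x <= b -> a <= y <= b ->
    `|phi y - phi x - D x * ((y - x) + q x / 2 * (y - x) ^+ 2)| <=
      e * (y - x) ^+ 2 + C * (y - x) ^+ 4 }.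

Variables (a b : R) (phi D q : R -> R) (k K Q : R).
Hypothesis so : second_order a b phi D q k K Q.

Lemma so_dist x y : a <= x <= b -> a <= y <= b ->
  k * `|y - x| <= `|phi y - phi x| <= K * `|y - x|.
Proof.
have k0 := so_k_gt0 so.
wlog xy : x y / x <= y => [hw|] xab yab.
  have [xy|/ltW yx] := leP x y; first exact: hw.
  by rewrite [`|y - x|]distrC [`|phi _ - _|]distrC; exact: hw.
have /andP[ax _] := xab; have /andP[_ yb] := yab.
have /andP[h1 h2] := so_incr so ax xy yb.
have yx0 : 0 <= y - x by rewrite subr_ge0.
rewrite (ger0_norm yx0) ger0_norm ?h1//.
by apply: le_trans h1; rewrite mulr_ge0// ltW.
Qed.

Lemma so_lt x y : a <= x <= b -> a <= y <= b -> phi x <= phi y -> x <= y.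
Proof.
move=> /andP[ax xb] /andP[ay yb] pxy; rewrite leNgt; apply/negP => yx.
have /andP[h _] := so_incr so ay (ltW yx) xb.
have : 0 < k * (x - y) by rewrite mulr_gt0 ?(so_k_gt0 so)// subr_gt0.
lra.
Qed.

Lemma so_K_ge0 : a <= b -> 0 <= K.
Proof.
move=> ab; have /andP[h1 h2] := so_D so (x := a) ltac:(by rewrite lexx ab).
by rewrite (le_trans (ltW (so_k_gt0 so)))// (le_trans h1 h2).
Qed.

Lemma lip1_so L g : 0 <= K -> lip1 L g -> (forall z, a <= g z <= b) ->
  lip1 (K * L) (phi \o g).
Proof.
move=> K0 gL gab x y /=; rewrite -mulrA.
have /andP[_ h] := so_dist (gab y) (gab x).
by apply: le_trans h _; rewrite ler_wpM2l.
Qed.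

Lemma bl_itv L g : 0 <= L -> lip1 L g -> (forall z, a <= g z <= b) -> bl g.
Proof.
move=> L0 gL gab; exists L, (`|a| + `|b|); split=> // x.
have /andP[h1 h2] := gab x; rewrite ler_norml; apply/andP; split.
  rewrite lerNl; apply: (@le_trans _ _ (- a)); first by rewrite lerN2.
  by rewrite -normrN; apply: le_trans (ler_norm _) _; rewrite lerDl.
by apply: le_trans h2 _; apply: le_trans (ler_norm _) _; rewrite lerDr.
Qed.

Lemma so_itv x : a <= x <= b -> phi a <= phi x <= phi b.
Proof.
move=> /andP[ax xb]; have k0 := ltW (so_k_gt0 so).
have /andP[h1 _] := so_incr so (lexx a) ax xb.
have /andP[h2 _] := so_incr so ax xb (lexx b).
rewrite -subr_ge0 -[phi x <= _]subr_ge0.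
by rewrite (le_trans _ h1) ?(le_trans _ h2)// mulr_ge0// subr_ge0.
Qed.

Lemma bl_so L g : 0 <= K -> 0 <= L -> lip1 L g -> (forall z, a <= g z <= b) ->
  bl (phi \o g).
Proof.
move=> K0 L0 gL gab; exists (K * L), (`|phi a| + `|phi b|); split=> [||x].
- exact: mulr_ge0.
- exact: lip1_so.
have /andP[h1 h2] := so_itv (gab x); rewrite ler_norml /=; apply/andP; split.
  rewrite lerNl; apply: (@le_trans _ _ (- phi a)); first by rewrite lerN2.
  by rewrite -normrN; apply: le_trans (ler_norm _) _; rewrite lerDl.
by apply: le_trans h2 _; apply: le_trans (ler_norm _) _; rewrite lerDr.
Qed.

Lemma mean_expansion (L e : R) : a <= b -> 0 <= L -> 0 < e ->
  exists2 d0 : R, 0 < d0 & forall s g x mu, 0 <= s -> s <= d0 ->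
  lip1 L g -> (forall z, a <= g z <= b) -> a <= mu <= b ->
  phi mu = heat s (phi \o g) x ->
  `|mu - (heat s g x + q (heat s g x) / 2 * heat_var s g x)| <= e * s.
Proof.
move=> ab L0 e0; have [Km Km0 hKm] := @heat_central_moments R n.
have K0 := so_K_ge0 ab; have k0 := so_k_gt0 so.
have Q0 : 0 <= Q.
  by apply: le_trans (so_q so (x := a) _); rewrite ?normr_ge0 ?lexx ?ab.
have [A AE] : exists A, A = Km * L ^+ 2 by eexists.
have A0 : 0 <= A by rewrite AE mulr_ge0// sqr_ge0.
have A1 : 0 < A + 1 by rewrite ltr_wpDl.
have [e1 e1E] : exists e1, e1 = k * e / (2 * (A + 1)) by eexists.
have e10 : 0 < e1 by rewrite e1E divr_gt0 ?mulr_gt0.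
have [C C0 hC] := so_taylor so e10.
have [B BE] : exists B, B = (K * Q * A + e1 * A + C * A ^+ 2) / k by eexists.
have B0 : 0 <= B.
  by rewrite BE divr_ge0 ?(ltW k0)// !addr_ge0// !mulr_ge0 ?sqr_ge0 ?(ltW e10).
have [Z ZE] : exists Z, Z = C * A ^+ 2 + K * Q * B ^+ 2 + e1 * B ^+ 2 + C * B ^+ 4.
  by eexists.
have Z0 : 0 <= Z.
  by rewrite ZE !addr_ge0// !mulr_ge0 ?sqr_ge0 ?expr4_ge0 ?(ltW e10).
exists (Num.min 1 (k * e / (2 * (Z + 1)))).
  by rewrite lt_min ltr01 divr_gt0 ?mulr_gt0// ltr_wpDl.
move=> s g x mu s0 + gL gab muab muE; rewrite le_min => /andP[s1 sZ].
have bg : bl g := bl_itv L0 gL gab.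
have bpg : bl (phi \o g) := bl_so K0 L0 gL gab.
set m := heat s g x; set W := heat_var s g x.
have mab : a <= m <= b by exact: heat_itv.
have [W1 W4] := hKm L g s x L0 gL bg s0.
have W0 : 0 <= W by exact: heat_var_ge0.
rewrite -AE in W1 W4.
have /andP[kD DK] := so_D so mab.
have qQ := so_q so mab.
pose Y y := g (x + Num.sqrt s *: y).
have bY : gbmeas Y by exact: gbmeas_shift.
have bYm : gbmeas (fun y => Y y - m) by apply: gbmeasB => //; exact: gbmeas_cst.
have bY2 := gbmeasX 2 bYm. have bY4 := gbmeasX 4 bYm.
have bpY : gbmeas (fun y => phi (Y y)) by exact: (gbmeas_shift x _ bpg).
have EYm : E (fun y => Y y - m) = 0.
  rewrite (gaussian_integralB bY (gbmeas_cst _)) gaussian_integral_cst.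
  by rewrite /m /heat subrr.
have main : `|phi mu - phi m - D m * (q m / 2 * W)| <= (e1 * A + C * A ^+ 2 * s) * s.
  have b3 := gbmeasB (gbmeasB bpY (gbmeas_cst (phi m)))
    (gbmeasZ (D m) (gbmeasD bYm (gbmeasZ (q m / 2) bY2))).
  have b4 := gbmeasD (gbmeasZ e1 bY2) (gbmeasZ C bY4).
  pose F y := phi (Y y) - phi m - D m * ((Y y - m) + q m / 2 * (Y y - m) ^+ 2).
  pose G y := e1 * (Y y - m) ^+ 2 + C * (Y y - m) ^+ 4.
  have EF : E F = phi mu - phi m - D m * (q m / 2 * W).
    rewrite (gaussian_integralB (gbmeasB bpY (gbmeas_cst (phi m)))
      (gbmeasZ (D m) (gbmeasD bYm (gbmeasZ (q m / 2) bY2)))).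
    rewrite (gaussian_integralB bpY (gbmeas_cst (phi m))) gaussian_integral_cst.
    rewrite (gaussian_integralZ _ (gbmeasD bYm (gbmeasZ (q m / 2) bY2))).
    rewrite (gaussian_integralD bYm (gbmeasZ (q m / 2) bY2)) EYm add0r.
    by rewrite (gaussian_integralZ _ bY2) muE.
  have EG : E G <= (e1 * A + C * A ^+ 2 * s) * s.
    rewrite (gaussian_integralD (gbmeasZ e1 bY2) (gbmeasZ C bY4)).
    rewrite (gaussian_integralZ _ bY2) (gaussian_integralZ _ bY4).
    rewrite mulrDl; apply: lerD.
      by rewrite -mulrA ler_wpM2l// ltW.
    have -> : C * A ^+ 2 * s * s = C * (A * s) ^+ 2 by ring.
    by rewrite ler_wpM2l.
  rewrite -EF; apply: le_trans EG.
  have FG y : `|F y| <= G y by apply: hC => //; exact: gab.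
  rewrite ler_norml -lerN2 opprK.
  have -> : - E F = E (fun y => -1 * F y) by rewrite (gaussian_integralZ _ b3) mulN1r.
  apply/andP; split.
    apply: (le_gaussian_integral (gbmeasZ (-1) b3) b4) => y; rewrite mulN1r.
    by apply: le_trans (FG y); rewrite -normrN; exact: ler_norm.
  apply: (le_gaussian_integral b3 b4) => y.
  by apply: le_trans (FG y); exact: ler_norm.
have As0 : 0 <= A * s by rewrite mulr_ge0.
have half (r : R) : `|r| <= Q -> `|r / 2| <= Q / 2.
  by move=> rQ; rewrite normrM ler_pM// ger0_norm.
have e1s : (e1 * A + C * A ^+ 2 * s) * s <= (e1 * A + C * A ^+ 2) * s.
  by rewrite ler_wpM2r// lerD2l ler_piMr// mulr_ge0// sqr_ge0.
have mum : `|mu - m| <= B * s.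
  have /andP[h _] := so_dist mab muab.
  rewrite BE mulrAC ler_pdivlMr// mulrC; apply: le_trans h _.
  rewrite -[phi mu - phi m](subrK (D m * (q m / 2 * W))).
  apply: le_trans (ler_normD _ _) _.
  have -> : (K * Q * A + e1 * A + C * A ^+ 2) * s =
    (e1 * A + C * A ^+ 2) * s + K * (Q * (A * s)) by ring.
  apply: lerD; first exact: le_trans main e1s.
  rewrite !normrM (ger0_norm (le_trans (ltW k0) kD)) (ger0_norm W0).
  rewrite ler_pM ?mulr_ge0 ?normr_ge0 ?(le_trans (ltW k0) kD)//.
  rewrite ler_pM ?mulr_ge0 ?normr_ge0//.
  rewrite -[leRHS]mulr1 ler_pM//.
  by rewrite ger0_norm// invf_le1// ler1n.
have mum0 : 0 <= `|mu - m| by [].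
have mum2 : (mu - m) ^+ 2 <= (B * s) ^+ 2.
  by rewrite -real_normK ?num_real// ler_pXn2r ?nnegrE// mulr_ge0.
have mum4 : (mu - m) ^+ 4 <= (B * s) ^+ 4.
  rewrite -[4%N]/(2 * 2)%N !exprM ler_pXn2r ?nnegrE ?sqr_ge0//.
have tay := hC _ _ mab muab.
have fin : D m * `|mu - (m + q m / 2 * W)| <= (e1 * A + Z * s) * s.
  rewrite -{1}(ger0_norm (le_trans (ltW k0) kD)) -normrM.
  have -> : D m * (mu - (m + q m / 2 * W)) =
    (phi mu - phi m - D m * (q m / 2 * W)) -
    (phi mu - phi m - D m * ((mu - m) + q m / 2 * (mu - m) ^+ 2)) -
    D m * (q m / 2 * (mu - m) ^+ 2) by ring.
  apply: le_trans (ler_normB _ _) _; apply: le_trans (lerD (ler_normB _ _) (lexx _)) _.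
  have t1 : `|D m * (q m / 2 * (mu - m) ^+ 2)| <= K * Q * (B ^+ 2 * s * s).
    rewrite normrM (ger0_norm (le_trans (ltW k0) kD)) normrM -mulrA.
    rewrite ler_pM ?mulr_ge0 ?normr_ge0 ?(le_trans (ltW k0) kD)//.
    rewrite ler_pM ?normr_ge0//; last first.
      by rewrite ger0_norm ?sqr_ge0// (le_trans mum2)// le_eqVlt; apply/orP; left; apply/eqP; ring.
    apply: le_trans (half _ qQ) _; rewrite ler_pdivrMr// ler_peMr//.
    by rewrite ler1n.
  have t2 : e1 * (mu - m) ^+ 2 + C * (mu - m) ^+ 4 <=
      e1 * (B ^+ 2 * s * s) + C * (B ^+ 4 * s * s).
    apply: lerD.
      by rewrite ler_wpM2l ?(ltW e10)// (le_trans mum2)// le_eqVlt; apply/orP; left; apply/eqP; ring.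
    rewrite ler_wpM2l// (le_trans mum4)//.
    have -> : B ^+ 4 * s * s = B ^+ 4 * s ^+ 2 by ring.
    have -> : (B * s) ^+ 4 = B ^+ 4 * (s ^+ 2 * s ^+ 2) by ring.
    by rewrite ler_wpM2l ?expr4_ge0// ler_piMr ?sqr_ge0// exprn_ile1.
  have := main; move: tay t1 t2; rewrite ZE; set X1 := `|_|; set X2 := `|_|; set X3 := `|_|.
  lra.
have kfin : k * `|mu - (m + q m / 2 * W)| <= k * (e * s).
  apply: (@le_trans _ _ (D m * `|mu - (m + q m / 2 * W)|)); first by rewrite ler_wpM2r.
  apply: le_trans fin _; rewrite mulrA ler_wpM2r//.
  have h1 : e1 * A <= k * e / 2.
    have -> : e1 * A = k * e / 2 * (A / (A + 1)).
      by rewrite e1E; field; rewrite gt_eqF.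
    by rewrite ler_piMr ?ler_pdivrMr ?mul1r ?lerDl// ltW// divr_gt0// mulr_gt0.
  have h2 : Z * s <= k * e / 2.
    apply: (@le_trans _ _ (Z * (k * e / (2 * (Z + 1))))); first by rewrite ler_wpM2l.
    have Z1 : 0 < Z + 1 by rewrite ltr_wpDl.
    have -> : Z * (k * e / (2 * (Z + 1))) = k * e / 2 * (Z / (Z + 1)).
      by field; rewrite gt_eqF.
    by rewrite ler_piMr ?ler_pdivrMr ?mul1r ?lerDl// ltW// divr_gt0// mulr_gt0.
  lra.
by move: kfin; rewrite ler_pM2l.
Qed.

End expansion.

Lemma upper_mean_arith (R : realFieldType) (m M v w r p e : R) :
  M - (m + - r / 2 * v) <= e -> p * w * r <= v * r ->
  M <= m - p / 2 * (w * r) + e.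
Proof. lra. Qed.

Lemma lower_mean_arith (R : realFieldType) (m mu w r p e e' : R) :
  - e' <= mu - (m + - (p * r) / 2 * w) -> e' <= e ->
  m - p / 2 * (w * r) + e <= mu + (e + e).
Proof. lra. Qed.

Section core.
Context {R : realType} {n : nat}.
Local Notation V := 'rV[R]_n.
Implicit Types (g h : V -> R) (s t : R).

Variables (a b : R) (phi1 D1 q1 : R -> R) (k1 K1 Q1 : R).
Variables (phip Dp qp : R -> R) (kp Kp Qp : R).
Hypothesis ab : a <= b.
Hypothesis so1 : second_order a b phi1 D1 q1 k1 K1 Q1.
Hypothesis sop : second_order a b phip Dp qp kp Kp Qp.
Variables (p : R) (rho : R -> R).
Hypothesis p1 : 1 <= p.
Hypothesis rho0 : forall x, a <= x <= b -> 0 < rho x.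
Hypothesis q1E : forall x, a <= x <= b -> q1 x = - (rho x)^-1.
Hypothesis qpE : forall x, a <= x <= b -> qp x = - (p / rho x).
Hypothesis rho_concave : forall x, a <= x <= b ->
  exists w, forall y, a <= y <= b -> rho y <= rho x + w * (y - x).

Lemma one_step (L e : R) : 0 <= L -> 0 < e ->
  exists2 d0 : R, 0 < d0 & forall d s g M x mu,
  0 < d -> d <= d0 -> 0 <= s -> lip1 L g -> (forall z, a <= g z <= b) ->
  bl M -> (forall z, a <= M z <= b) ->
  (forall z, phi1 (M z) = heat d (phi1 \o g) z) ->
  a <= mu <= b ->
  phip mu = heat (d / p) (phip \o heat (s + (d - d / p)) g) x ->
  heat s M x <= mu + e * d.
Proof.
move=> L0 e0; have e20 : 0 < e / 2 by rewrite divr_gt0.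
have [d1 d10 H1] := @mean_expansion _ n _ _ _ _ _ _ _ _ so1 L _ ab L0 e20.
have [d2 d20 H2] := @mean_expansion _ n _ _ _ _ _ _ _ _ sop L _ ab L0 e20.
exists (Num.min d1 d2); first by rewrite lt_min d10 d20.
move=> d s g M x mu d0 + s0 gL gab bM Mab ME muab muE.
rewrite le_min => /andP[dd1 dd2].
have p0 : 0 < p by rewrite (lt_le_trans ltr01).
have [t tE] : exists t, t = d / p by eexists.
rewrite -tE in muE.
have t0 : 0 <= t by rewrite tE divr_ge0 ?ltW.
have td : t <= d by rewrite tE ler_pdivrMr// ler_peMr// ltW.
have dt0 : 0 <= d - t by rewrite subr_ge0.
have bg : bl g := bl_itv L0 gL gab.
have [k kE] : exists k, k = heat (d - t) g by eexists.
have bk : bl k by rewrite kE; exact: bl_heat.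
have kL : lip1 L k by rewrite kE; exact: lip1_heat.
have kab z : a <= k z <= b by rewrite kE; exact: heat_itv.
have mE z : heat t k z = heat d g z.
  have dE : t + (d - t) = d by ring.
  by rewrite kE (heat_heat z t0 dt0 bg) dE.
have hE : heat (s + (d - t)) g = heat s k.
  by apply/funext => z; rewrite kE (heat_heat z s0 dt0 bg).
rewrite hE in muE.
have bh : bl (heat s k) by exact: bl_heat.
have hL : lip1 L (heat s k) by exact: lip1_heat.
have hab z : a <= heat s k z <= b by exact: heat_itv.
set mb := heat (s + t) k x.
have mbE : heat t (heat s k) x = mb by rewrite (heat_heat x t0 s0 bk) [t + s]addrC.
have mbab : a <= mb <= b by exact: heat_itv.
have [w hw] := rho_concave mbab.
have := H2 t (heat s k) x mu t0 (le_trans td dd2) hL hab muab muE.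
rewrite mbE (qpE mbab) ler_norml => /andP[+ _].
set W := heat_var t (heat s k) x => low.
have up z : M z <= heat t k z - p / 2 * (heat_var t k z / rho (heat t k z)) + e / 2 * d.
  have := H1 d g z (M z) (ltW d0) dd1 gL gab (Mab z) (ME z).
  have mab : a <= heat d g z <= b by exact: heat_itv.
  rewrite (q1E mab) mE ler_norml => /andP[_ h].
  have := heat_var_contraction z (ltW d0) p1 bg.
  rewrite -tE -kE => hv.
  have : p * heat_var t k z / rho (heat d g z) <= heat_var d g z / rho (heat d g z).
    by rewrite ler_wpM2r// invr_ge0 ltW// rho0.
  exact: upper_mean_arith.
have h0 z : 0 < rho (heat t k z) <= rho mb + w * (heat t k z - heat (s + t) k x).
  have zab : a <= heat t k z <= b by exact: heat_itv.
  by rewrite rho0//= hw.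
have p20 : 0 <= p / 2 by rewrite divr_ge0// ltW.
have := @heat_le_mean_var _ _ s t k x M (rho \o heat t k) (p / 2) (rho mb) w
  (e / 2 * d) s0 t0 bk bM p20 (rho0 mbab) h0 up.
rewrite -/W -/mb => h; apply: le_trans h _.
have et : e / 2 * t <= e / 2 * d by rewrite ler_wpM2l// ltW.
have -> : e * d = e / 2 * d + e / 2 * d by rewrite -mulrDl -splitr.
exact: (lower_mean_arith low et).
Qed.

Hypothesis onto1 : forall w, phi1 a <= w <= phi1 b ->
  exists2 x, a <= x <= b & phi1 x = w.
Hypothesis ontop : forall w, phip a <= w <= phip b ->
  exists2 x, a <= x <= b & phip x = w.

Lemma so_le_add x y r : a <= x <= b -> a <= y <= b -> 0 <= r -> x <= y + r ->
  phip x <= phip y + Kp * r.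
Proof.
move=> xab yab r0 xyr; have K0 := so_K_ge0 sop ab.
have [xy|/ltW yx] := leP x y.
  have /andP[ax _] := xab; have /andP[_ yb] := yab.
  have /andP[h _] := so_incr sop ax xy yb.
  rewrite (@le_trans _ _ (phip y)) ?lerDl ?mulr_ge0//.
  rewrite -subr_ge0; apply: le_trans h.
  by rewrite mulr_ge0 ?subr_ge0// ltW// (so_k_gt0 sop).
have /andP[_ xb] := xab; have /andP[ay _] := yab.
have /andP[_ h] := so_incr sop ay yx xb.
have : Kp * (x - y) <= Kp * r by rewrite ler_wpM2l// lerBlDl.
lra.
Qed.

Lemma so1_inj x y : a <= x <= b -> a <= y <= b -> phi1 x = phi1 y -> x = y.
Proof.
move=> xab yab e; apply/le_anti; rewrite (so_lt so1 xab yab) ?e//.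
by rewrite (so_lt so1 yab xab) ?e.
Qed.

Theorem heat_mean_le (L : R) f (x0 : V) mu1 mup :
  0 <= L -> lip1 L f -> (forall z, a <= f z <= b) ->
  a <= mu1 <= b -> phi1 mu1 = heat 1 (phi1 \o f) x0 ->
  a <= mup <= b -> phip mup = heat p^-1 (phip \o heat (1 - p^-1) f) x0 ->
  mu1 <= mup.
Proof.
move=> L0 fL fab mu1ab mu1E mupab mupE.
have p0 : 0 < p by rewrite (lt_le_trans ltr01).
have K10 := so_K_ge0 so1 ab; have Kp0 := so_K_ge0 sop ab.
have k10 := so_k_gt0 so1.
have bf : bl f := bl_itv L0 fL fab.
have bpf : bl (phi1 \o f) := bl_so so1 K10 L0 fL fab.
have ex s (z : V) : exists x, a <= x <= b /\ phi1 x = heat s (phi1 \o f) z.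
  have [|x xab xE] := onto1 (w := heat s (phi1 \o f) z); last by exists x.
  by apply: heat_itv => // w; exact: (so_itv so1 (fab w)).
have [M [Mab ME]] : exists M : R -> V -> R, (forall s z, a <= M s z <= b) /\
    (forall s z, phi1 (M s z) = heat s (phi1 \o f) z).
  have /choice[M HM] : forall sz : R * V, exists x : R,
    a <= x <= b /\ phi1 x = heat sz.1 (phi1 \o f) sz.2 by move=> [s z]; exact: ex.
  by exists (fun s z => M (s, z)); split=> s z; have [] := HM (s, z).
pose L' := K1 * L / k1.
have L'0 : 0 <= L' by rewrite divr_ge0 ?mulr_ge0// ltW.
have ML s : lip1 L' (M s).
  move=> x y; rewrite /L' mulrAC ler_pdivlMr// mulrC.
  have /andP[h _] := so_dist so1 (Mab s y) (Mab s x).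
  apply: le_trans h _; rewrite !ME.
  by apply: lip1_heat => //; [exact: mulr_ge0|exact: (lip1_so so1)].
have bM s : bl (M s) := bl_itv L'0 (ML s) (Mab s).
have hM s t z : a <= heat s (M t) z <= b by apply: heat_itv => //; exact: Mab.
have bph s t : bl (phip \o heat s (M t)).
  by apply: (bl_so sop Kp0 L'0); [exact: lip1_heat|exact: hM].
have M0E : M 0 = f.
  by apply/funext => z; apply: so1_inj => //; rewrite ME heat0.
have M1E : M 1 x0 = mu1 by apply: so1_inj => //; rewrite ME mu1E.
apply: (so_lt sop mu1ab mupab); apply/ler_addgt0Pr => e e0.
have Kp1 : 0 < Kp + 1 by rewrite ltr_wpDl.
have [e' e'E] : exists e', e' = e / (Kp + 1) by eexists.
have e'0 : 0 < e' by rewrite e'E divr_gt0.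
have [d0 d00 OS] := one_step L'0 e'0.
have [N N0 Nd0] : exists2 N : nat, (0 < N)%N & (N%:R)^-1 <= d0.
  exists (Num.truncn d0^-1).+1 => //.
  rewrite invf_ple ?posrE// ltW//.
  have d0V : 0 <= d0^-1 by rewrite invr_ge0 ltW.
  by have /andP[] := truncn_itv d0V.
have NR : 0 < N%:R :> R by rewrite ltr0n.
have [d dE] : exists d : R, d = N%:R^-1 by eexists.
have d_gt0 : 0 < d by rewrite dE invr_gt0.
have dd0 : d <= d0 by rewrite dE.
have Nd : N%:R * d = 1 by rewrite dE mulfV// gt_eqF.
have dp0 : 0 <= d / p by rewrite divr_ge0 ?ltW.
have dpd : 0 <= d - d / p by rewrite subr_ge0 ler_pdivrMr// ler_peMr// ltW.
have [Psi PsiE] : exists Psi : nat -> R, forall j, Psi j = heat (j%:R * (d / p))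
    (phip \o heat (j%:R * (d - d / p)) (M (1 - j%:R * d))) x0.
  by eexists => j; reflexivity.
have step j : (j < N)%N -> Psi j <= Psi j.+1 + Kp * (e' * d).
  move=> jN; rewrite !PsiE.
  have jE (r : R) : j.+1%:R * r = j%:R * r + r by rewrite -natr1 mulrDl mul1r.
  rewrite !jE; set s := j%:R * (d - d / p); set g := M (1 - (j%:R * d + d)).
  have jdp : 0 <= j%:R * (d / p) by rewrite mulr_ge0.
  have s0 : 0 <= s by rewrite mulr_ge0.
  have rem0 : 0 <= 1 - (j%:R * d + d).
    by rewrite -jE subr_ge0 -[leRHS]Nd ler_wpM2r ?ler_nat// ltW.
  have gE : phi1 \o g = heat (1 - (j%:R * d + d)) (phi1 \o f).
    by apply/funext => z; exact: ME.
  have MjE z : phi1 (M (1 - j%:R * d) z) = heat d (phi1 \o g) z.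
    have E : d + (1 - (j%:R * d + d)) = 1 - j%:R * d by ring.
    by rewrite ME gE (heat_heat z (ltW d_gt0) rem0 bpf) E.
  set H := heat (d / p) (phip \o heat (s + (d - d / p)) g).
  have bH : bl H by apply: bl_heat; exact: bph.
  rewrite -(heat_heat x0 jdp dp0 (bph _ _)) -/H.
  have -> : heat (j%:R * (d / p)) H x0 + Kp * (e' * d) =
      heat (j%:R * (d / p)) (fun z => H z + Kp * (e' * d)) x0.
    by rewrite (heatD _ _ bH (bl_cst _)) heat_cst.
  apply: le_heat; [exact: bph|exact: (blD bH (bl_cst _))|move=> z /=].
  have Hz : phip a <= H z <= phip b.
    apply: heat_itv; first exact: bph.
    by move=> w /=; exact: (so_itv sop (hM _ _ _)).
  have [mu muab muE] := ontop Hz.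
  rewrite -muE; apply: (so_le_add (hM _ _ _) muab).
  - by rewrite mulr_ge0 ?ltW.
  - exact: (OS d s g _ z mu d_gt0 dd0 s0 (ML _) (Mab _) (bM _) (Mab _) MjE muab muE).
have sum j : (j <= N)%N -> Psi 0%N <= Psi j + j%:R * (Kp * (e' * d)).
  elim: j => [_|j IH jN]; first by rewrite mul0r addr0.
  apply: le_trans (IH (ltnW jN)) _; rewrite -[j.+1%:R]natr1 mulrDl mul1r.
  by rewrite [leRHS]addrA [leRHS]addrAC lerD2r; exact: step.
have := sum N (leqnn N).
have -> : Psi 0%N = phip mu1.
  by rewrite PsiE !mul0r heat0/= heat0 subr0 M1E.
have -> : Psi N = phip mup.
  rewrite PsiE Nd subrr M0E mupE.
  have -> : N%:R * (d / p) = p^-1 by rewrite mulrA Nd mul1r.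
  by have -> : N%:R * (d - d / p) = 1 - p^-1 by rewrite mulrBr mulrA Nd mul1r.
move=> h; apply: le_trans h _; rewrite lerD2l.
have -> : N%:R * (Kp * (e' * d)) = (N%:R * d) * (Kp * e') by ring.
rewrite Nd mul1r e'E mulrA ler_pdivrMr// mulrC ler_wpM2l ?ltW//.
by rewrite ltrDl.
Qed.

End core.

(** * The functions [u c t] *)

Section calculus.
Context {R : realType}.
Implicit Types (f df F : R -> R).

Lemma MVT_between f df (a b x y : R) : a <= x <= b -> a <= y <= b ->
  (forall z, a <= z <= b -> is_derive z (1 : R) f (df z)) ->
  exists2 z, a <= z <= b & `|z - x| <= `|y - x| /\ f y - f x = df z * (y - x).
Proof.
have key (x' y' : R) : x' <= y' -> a <= x' -> y' <= b ->
    (forall z, a <= z <= b -> is_derive z (1 : R) f (df z)) ->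
    exists2 z, x' <= z <= y' & f y' - f x' = df z * (y' - x').
  move=> xy ax yb fd.
  have sub z : x' <= z <= y' -> a <= z <= b.
    by move=> /andP[xz zy]; rewrite (le_trans ax xz) (le_trans zy yb).
  have [||z] := @MVT_segment _ f df x' y' xy.
  - move=> z /[!in_itv]/= /andP[xz zy]; apply: fd; apply: sub.
    by rewrite !ltW.
  - apply: derivable_within_continuous => z /[!in_itv]/= zxy.
    by have [] := fd z (sub z zxy).
  - by rewrite in_itv/= => zxy E; exists z.
move=> /andP[ax xb] /andP[ay yb] fd; have [xy|/ltW yx] := leP x y.
  have [z /andP[xz zy] E] := key _ _ xy ax yb fd.
  exists z; first by rewrite (le_trans ax xz) (le_trans zy yb).
  by split=> //; rewrite !ger0_norm ?subr_ge0// lerD2r.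
have [z /andP[yz zx] E] := key _ _ yx ay xb fd.
exists z; first by rewrite (le_trans ay yz) (le_trans zx xb).
split; first by rewrite !ler0_norm ?subr_le0// lerN2 lerD2r.
by rewrite -opprB E -mulrN opprB.
Qed.

Lemma uniform_continuity_segment f (a b : R) :
  (forall z, a <= z <= b -> {for z, continuous f}) ->
  forall e, 0 < e -> exists2 eta, 0 < eta &
    forall x y, a <= x <= b -> a <= y <= b -> `|x - y| < eta -> `|f x - f y| <= e.
Proof.
move=> cf e e0.
have /compact_near_coveringP := @segment_compact R a b.
move=> /(_ R (0^'+)%classic (fun eta x => forall y, a <= y <= b ->
   `|x - y| < eta -> `|f x - f y| <= e) _) h.
have {h} : \forall eta \near 0^'+, `[a, b] `<=` (fun x => forall y, a <= y <= b ->
   `|x - y| < eta -> `|f x - f y| <= e).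
  apply: h => x; rewrite /= in_itv/= => xab.
  have e20 : 0 < e / 2 by rewrite divr_gt0.
  have /cvgrPdist_le /(_ _ e20) [r /= r0 hr] := cf x xab.
  have r20 : 0 < r / 2 by rewrite divr_gt0.
  exists (ball x (r / 2), [set eta | eta < r / 2]) => /=.
    split; first exact: nbhsx_ballx.
    by exists (r / 2) => //= z /= + _; rewrite sub0r normrN; apply: le_lt_trans; exact: ler_norm.
  move=> [x' eta] /= [xx' etar] y yab xy.
  have h1 : `|f x - f x'| <= e / 2.
    apply: hr => /=; apply: lt_le_trans xx' _.
    by rewrite ler_pdivrMr// ler_peMr ?ltW// ltr1n.
  have h2 : `|f x - f y| <= e / 2.
    apply: hr => /=; rewrite (splitr r).
    rewrite (le_lt_trans (ler_distD x' _ _))// ltrD//.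
    exact: lt_trans xy etar.
  rewrite (splitr e) (le_trans (ler_distD (f x) _ _))// lerD// distrC//.
move=> [r /= r0 hr]; exists (r / 2); first by rewrite divr_gt0.
move=> x y xab yab xy; apply: (hr (r / 2)) => //=.
- rewrite sub0r normrN gtr0_norm ?divr_gt0// ltr_pdivrMr// ltr_pMr// ltr1n//.
- by rewrite divr_gt0.
Qed.

Lemma second_order_of_C2 (a b k K Q : R) (phi D q : R -> R) : 0 < k ->
  (forall x, a <= x <= b -> is_derive x (1 : R) phi (D x)) ->
  (forall x, a <= x <= b -> is_derive x (1 : R) D (D x * q x)) ->
  (forall x, a <= x <= b -> {for x, continuous (fun y => D y * q y)}) ->
  (forall x, a <= x <= b -> k <= D x <= K) ->
  (forall x, a <= x <= b -> `|q x| <= Q) ->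
  second_order a b phi D q k K Q.
Proof.
move=> k0 dphi dD cD2 hD hq; split=> // [x y ax xy yb|e e0].
  have xab : a <= x <= b by rewrite ax (le_trans xy).
  have yab : a <= y <= b by rewrite yb (le_trans ax).
  have [z zab [_ ->]] := MVT_between xab yab dphi.
  by have /andP[h1 h2] := hD z zab; rewrite !ler_wpM2r ?subr_ge0.
have [eta eta0 heta] := uniform_continuity_segment cD2 e0.
have D2b x : a <= x <= b -> `|D x * q x| <= K * Q.
  move=> xab; have /andP[h1 h2] := hD x xab.
  by rewrite normrM ler_pM// ?hq// ger0_norm// (le_trans (ltW k0)).
exists (2 * `|K * Q| / eta ^+ 2).
  by rewrite divr_ge0 ?sqr_ge0// mulr_ge0.
move=> x y xab yab.
pose G z := phi z - phi x - D x * ((z - x) + q x / 2 * (z - x) ^+ 2).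
pose dG z := D z - D x - D x * q x * (z - x).
have dGP z : a <= z <= b -> is_derive z (1 : R) G (dG z).
  move=> zab; have dz := dphi z zab.
  have -> : G = phi \- cst (phi x) \- (D x *: ((id \- cst x) \+
      ((q x / 2) *: ((id \- cst x) ^+ 2)))).
    by apply/funext => w; rewrite /G.
  by apply: is_derive_eq; rewrite /dG /GRing.scale/= !subr0; field.
have [z zab [zx Gz]] := MVT_between xab yab dGP.
have Gx : G x = 0 by rewrite /G !subrr expr0n/= mulr0 addr0 mulr0 subr0.
rewrite -/(G y) -[G y]subr0 -Gx Gz.
have [w wab [wx Dw]] := MVT_between xab zab dD.
have -> : dG z = (D w * q w - D x * q x) * (z - x) by rewrite /dG Dw; ring.
have D2w : `|D w * q w - D x * q x| <= e + 2 * `|K * Q| / eta ^+ 2 * (y - x) ^+ 2.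
  have [wxe|wxe] := ltP `|w - x| eta.
    apply: le_trans (heta w x wab xab wxe) _; rewrite lerDl.
    by rewrite mulr_ge0 ?sqr_ge0// divr_ge0 ?sqr_ge0// mulr_ge0.
  apply: (@le_trans _ _ (2 * `|K * Q|)).
    apply: le_trans (ler_normB _ _) _; rewrite mulr_natl mulr2n.
    by apply: lerD; apply: (le_trans (D2b _ _)) => //; exact: ler_norm.
  rewrite -[leLHS]add0r; apply: lerD; first exact: ltW.
  rewrite mulrAC ler_pdivlMr ?exprn_gt0// ler_wpM2l ?mulr_ge0//.
  rewrite -[leRHS]real_normK ?num_real// ler_pXn2r ?nnegrE ?(ltW eta0)//.
  exact: (le_trans wxe (le_trans wx zx)).
have -> : e * (y - x) ^+ 2 + 2 * `|K * Q| / eta ^+ 2 * (y - x) ^+ 4 =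
   (e + 2 * `|K * Q| / eta ^+ 2 * (y - x) ^+ 2) * (`|y - x| * `|y - x|).
  by rewrite -expr2 real_normK ?num_real//; ring.
rewrite 2!normrM -[leLHS]mulrA.
by apply: ler_pM => //; rewrite ?mulr_ge0// ler_pM.
Qed.

Lemma convex_support (r : R -> R) :
  convex_function (`]0, +oo[%classic : set R) r ->
  forall x, 0 < x -> exists w, forall y, 0 < y -> r x + w * (y - x) <= r y.
Proof.
move=> cr x x0.
have conv y1 y2 : 0 < y1 -> y1 < x -> x < y2 ->
    r x * (y2 - y1) <= (y2 - x) * r y1 + (x - y1) * r y2.
  move=> y10 y1x xy2; have y12 : 0 < y2 - y1 by rewrite subr_gt0 (lt_trans y1x).
  pose l := (y2 - x) / (y2 - y1).
  have l0 : 0 <= l by rewrite divr_ge0 ?subr_ge0 ?ltW// (lt_trans y1x).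
  have l1 : l <= 1 by rewrite ler_pdivrMr// mul1r lerD2l lerN2 ltW.
  have := cr (Itv01 l0 l1) y1 y2.
  rewrite !inE/= !in_itv/= !andbT => /(_ y10 (lt_trans x0 xy2)).
  move=> h; have {h} : r (l * y1 + (1 - l) * y2) <= l * r y1 + (1 - l) * r y2 := h.
  have -> : l * y1 + (1 - l) * y2 = x by rewrite /l; field; rewrite gt_eqF.
  rewrite -(ler_pM2r y12) => h; apply: le_trans h _.
  by rewrite le_eqVlt; apply/orP; left; apply/eqP; rewrite /l; field; rewrite gt_eqF.
pose S := [set s | exists2 y, 0 < y < x & s = (r x - r y) / (x - y)].
have slope y1 y2 : 0 < y1 -> y1 < x -> x < y2 ->
    (r x - r y1) / (x - y1) <= (r y2 - r x) / (y2 - x).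
  move=> y10 y1x xy2; have := conv _ _ y10 y1x xy2.
  rewrite ler_pdivrMr ?subr_gt0// mulrAC ler_pdivlMr ?subr_gt0//; lra.
have S0 : S !=set0.
  exists ((r x - r (x / 2)) / (x - x / 2)), (x / 2) => //.
  by rewrite divr_gt0//= ltr_pdivrMr// ltr_pMr// ltr1n.
have Sub y2 : x < y2 -> ubound S ((r y2 - r x) / (y2 - x)).
  by move=> xy2 _ [y /andP[y0 yx] ->]; exact: slope.
have hS : has_sup S.
  by split=> //; exists ((r (x + 1) - r x) / (x + 1 - x)); apply: Sub; rewrite ltrDl.
exists (sup S) => y y0; have [yx|xy|->] := ltgtP y x; last by rewrite subrr mulr0 addr0.
  have : (r x - r y) / (x - y) <= sup S.
    by apply: ub_le_sup; [case: hS|exists y => //; rewrite y0].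
  rewrite ler_pdivrMr ?subr_gt0//; lra.
have : sup S <= (r y - r x) / (y - x) by apply: ge_sup => //; exact: Sub.
rewrite ler_pdivlMr ?subr_gt0//; lra.
Qed.

End calculus.

Section primitive.
Context {R : realType}.
Local Notation mu := (@lebesgue_measure R).
Variables (c : R -> R) (l : R).
Hypothesis c_gt0 : forall x : R, 0 < x -> 0 < c x.
Hypothesis c_C1 : C1_pos c.
Hypothesis c'_lt0 : forall x : R, 0 < x -> (c^`())%classic x < 0.
Hypothesis c_lim0 : c x @[x --> (0 : R)^'+] --> l.
Local Notation c' := (c^`())%classic.

Lemma C1_pos_is_derive (x : R) : 0 < x -> is_derive x (1 : R) c (c' x).
Proof. by move=> /c_C1[dc _]; rewrite derive1E; exact: DeriveDef. Qed.

Lemma C1_pos_continuous (x : R) : 0 < x -> {for x, continuous c}.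
Proof.
by move=> /C1_pos_is_derive[dc _]; exact/differentiable_continuous/derivable1_diffP.
Qed.

Lemma C1_pos_nonincreasing (x y : R) : 0 < x -> x <= y -> c y <= c x.
Proof.
move=> x0 xy.
have [||z z0|z /andP[xz zy] [_ E]] := @MVT_between _ c c' x y x y.
- by rewrite lexx.
- by rewrite lexx xy.
- apply: C1_pos_is_derive; have /andP[xz _] := z0; exact: lt_le_trans xz.
have := c'_lt0 (lt_le_trans x0 xz) => cz.
by rewrite -subr_le0 E mulr_le0_ge0 ?subr_ge0// ltW.
Qed.

Lemma C1_pos_le_lim (x : R) : 0 < x -> c x <= l.
Proof.
move=> x0; rewrite -(cvg_lim (@Rhausdorff R) c_lim0).
apply: limr_ge; first by apply/cvg_ex; exists l.
near=> y; apply: C1_pos_nonincreasing; near: y.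
  exact: nbhs_right_gt.
by apply: nbhs_right_le.
Unshelve. all: by end_near. Qed.

Variable P : R.
Hypothesis P_gt0 : 0 < P.

Lemma powR_is_derive (x : R) : 0 < x ->
  is_derive x (1 : R) (fun y => c y `^ P) (c x `^ P * (P * (c' x / c x))).
Proof.
move=> x0; have cx0 := c_gt0 x0.
have h1 := is_derive1_powR P cx0.
have h2 := C1_pos_is_derive x0.
have h := is_derive1_comp h1 h2.
apply: (is_derive_eq h).
rewrite powRB; last by rewrite (gt_eqF cx0) implybT.
by rewrite powRr1 ?ltW//; field; rewrite gt_eqF.
Qed.

Lemma powR_continuous (x : R) : 0 < x -> {for x, continuous (fun y => c y `^ P)}.
Proof.
by move=> /powR_is_derive[dc _]; exact/differentiable_continuous/derivable1_diffP.
Qed.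

Lemma powR_integrable (x : R) : mu.-integrable `]0, x[ (EFin \o (fun y => c y `^ P)).
Proof.
apply: measurable_bounded_integrable => //.
- rewrite /= lebesgue_measure_itv/=; case: ifPn => // _.
  by rewrite -EFinD ltry.
- apply: open_continuous_measurable_fun; first exact: interval_open.
  by move=> y; rewrite inE/= in_itv/= => /andP[y0 _]; exact: powR_continuous.
exists (l `^ P); split=> [|M lM y /=]; first exact: num_real.
rewrite in_itv/= => /andP[y0 _]; rewrite ger0_norm ?powR_ge0//.
apply: le_trans (ltW lM).
have cy0 := ltW (c_gt0 y0); have cyl := C1_pos_le_lim y0.
apply: (ge0_ler_powR (ltW P_gt0)) => //.
by rewrite nnegrE (le_trans cy0).
Qed.

Lemma primitive_is_derive (x : R) : 0 < x ->
  is_derive x (1 : R) (fun z => \int[mu]_(y in `]0, z[) c y `^ P) (c x `^ P).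
Proof.
move=> x0.
have -> : (fun z => \int[mu]_(y in `]0, z[) c y `^ P) =
    (fun z => \int[mu]_(y in `]0, z]) c y `^ P).
  by apply/funext => z; rewrite Rintegral_itv_bndo_bndc//; exact: powR_integrable.
have xx : x < x + 1 by rewrite ltrDl.
have int : mu.-integrable [set` Interval (BRight 0) (BRight (x + 1))]
    (EFin \o (fun y => c y `^ P)).
  apply: integrableS (powR_integrable (x + 2)) => //.
  by apply: subset_itvl; rewrite bnd_simp ltrD2l ltr1n.
have [d E] := @continuous_FTC1 R (fun y => c y `^ P) (BRight 0) x (x + 1)
  xx int x0 (powR_continuous x0).
by apply: DeriveDef; [exact: d|rewrite -derive1E; exact: E].
Qed.

End primitive.

Section u_second_order.
Context {R : realType}.
Variables (c : R -> R).
Hypothesis c_gt0 : forall x : R, 0 < x -> 0 < c x.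
Hypothesis c_C1 : C1_pos c.
Hypothesis c'_lt0 : forall x : R, 0 < x -> (c^`())%classic x < 0.
Hypothesis c_lim0 : exists l : R, c x @[x --> (0 : R)^'+] --> l.
Local Notation c' := (c^`())%classic.

Lemma log_derive_continuous (x : R) : 0 < x -> {for x, continuous (fun y => c' y / c y)}.
Proof.
move=> x0; have [_ cc'] := c_C1 x0.
apply: cvgM; first exact: cc'.
apply: cvgV; first by rewrite gt_eqF// c_gt0.
exact: (C1_pos_continuous c_C1).
Qed.

Lemma u_second_order t (a b : R) : 0 < a -> a <= b -> exists k K Q,
  second_order a b (u c t) (fun x => c x `^ expR (2 * t))
    (fun x => expR (2 * t) * (c' x / c x)) k K Q.
Proof.
move=> a0 ab; have P0 : 0 < expR (2 * t) by exact: expR_gt0.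
move: c_lim0 => [l hl].
have pos x : a <= x <= b -> 0 < x by move=> /andP[ax _]; exact: lt_le_trans ax.
have [M hM] : exists M : R, forall x, a <= x <= b -> `|c' x / c x| <= M.
  have ct : {within `[a, b], continuous (fun y => c' y / c y)}.
    apply: continuous_in_subspaceT => x; rewrite inE/= in_itv/= => /pos.
    exact: log_derive_continuous.
  have /compact_bounded[M [_ hM]] := continuous_compact ct (@segment_compact R a b).
  exists (M + 1) => x xab; apply: (hM (M + 1)); first by rewrite ltrDl.
  by exists x => //=; rewrite in_itv.
exists (c b `^ expR (2 * t)), (c a `^ expR (2 * t)), (expR (2 * t) * M).
have b0 : 0 < b by exact: lt_le_trans ab.
have mono x y : 0 < x -> x <= y -> c y `^ expR (2 * t) <= c x `^ expR (2 * t).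
  move=> x0 xy; have y0 := lt_le_trans x0 xy.
  apply: (ge0_ler_powR (ltW P0)); rewrite ?nnegrE ?(ltW (c_gt0 _))//.
  exact: (C1_pos_nonincreasing c_C1).
apply: second_order_of_C2.
- exact/powR_gt0/c_gt0.
- by move=> x /pos x0; exact: (primitive_is_derive c_gt0 c_C1 c'_lt0 hl).
- by move=> x /pos x0; exact: powR_is_derive.
- move=> x /pos x0; apply: cvgM; first exact: powR_continuous.
  by apply: cvgM; [exact: cvg_cst|exact: log_derive_continuous].
- move=> x xab; have x0 := pos x xab; have /andP[ax xb] := xab.
  by rewrite !mono.
- by move=> x xab; rewrite normrM gtr0_norm// ler_wpM2l ?hM// ltW.
Qed.

Lemma u_ge0 t x : 0 <= u c t x.
Proof. by apply: Rintegral_ge0 => y _; exact: powR_ge0. Qed.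

End u_second_order.

Section C1b0_lip1.
Context {R : realType} {d : nat}.
Variable f : 'rV[R]_d -> R.
Hypothesis f_der : forall (i : 'I_d) x, derivable f x (delta_mx 0 i).

Lemma is_derive_line (x : 'rV[R]_d) (i : 'I_d) (r : R) :
  is_derive r (1 : R) (fun r => f (x + r *: delta_mx 0 i))
    (partial i f (x + r *: delta_mx 0 i)).
Proof.
have E : (fun h : R => h^-1 *: (((fun r => f (x + r *: delta_mx 0 i)) \o shift r)
      (h *: (1 : R)) - f (x + r *: delta_mx 0 i))) =
    (fun h : R => h^-1 *: ((f \o shift (x + r *: delta_mx 0 i))
      (h *: delta_mx 0 i) - f (x + r *: delta_mx 0 i))).
  apply/funext => h /=; congr (_ *: (f _ - _)).
  by rewrite /GRing.scale/= mulr1 -[LHS]/(_ + (h + r) *: _) scalerDl addrCA.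
apply: DeriveDef.
  by rewrite /derivable E; exact: f_der.
by rewrite /partial /derive E.
Qed.

Lemma bounded_partial_lip1 : (forall i : 'I_d, bounded_fun (partial i f)) ->
  exists2 L, 0 <= L & lip1 L f.
Proof.
move=> bf.
have /choice[L0 hL0] : forall i : 'I_d, exists L : R,
    0 <= L /\ forall x, `|partial i f x| <= L.
  move=> i; have [M [_ hM]] := bf i; exists (`|M| + 1); split; first by rewrite addr_ge0.
  by move=> x; apply: (hM (`|M| + 1)) => //; rewrite ltr_pwDr// ler_norm.
pose L := \sum_i L0 i.
have L_ge0 : 0 <= L by apply: sumr_ge0 => i _; have [] := hL0 i.
have L0L i : L0 i <= L.
  rewrite /L (bigD1 i)//= lerDl; apply: sumr_ge0 => j _.
  by have [] := hL0 j.
exists L => //.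
have line x i (r : R) : `|f (x + r *: delta_mx 0 i) - f x| <= L * `|r|.
  pose g s := f (x + s *: delta_mx 0 i).
  have h0 : - `|r| <= 0 <= `|r| by rewrite oppr_le0 normr_ge0.
  have hr : - `|r| <= r <= `|r| by rewrite -ler_norml.
  have dg s : - `|r| <= s <= `|r| ->
      is_derive s (1 : R) g (partial i f (x + s *: delta_mx 0 i)).
    by move=> _; exact: is_derive_line.
  have [z _ [_ E]] := MVT_between h0 hr dg.
  have g0 : g 0 = f x by rewrite /g scale0r addr0.
  rewrite -[f (x + _)]/(g r) -g0 E subr0 normrM ler_wpM2r//.
  by apply: le_trans (L0L i); have [] := hL0 i.
move=> x y; rewrite distrC.
pose z k := \row_(j < d) (if (j < k)%N then y 0 j else x 0 j).
have z0 : z 0%N = x by apply/rowP => j; rewrite mxE.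
have zd : z d = y by apply/rowP => j; rewrite mxE ltn_ord.
have zS (i : 'I_d) : z i.+1 = z i + (y 0 i - x 0 i) *: delta_mx 0 i.
  apply/rowP => j; rewrite !mxE eqxx/= ltnS leq_eqVlt.
  have [->|ji] := eqVneq j i; first by rewrite ltnn eqxx mulr1 subrKC.
  by rewrite -val_eqE in ji; rewrite (negbTE ji) mulr0 addr0.
have -> : f y - f x = \sum_(i < d) (f (z i.+1) - f (z i)).
  by rewrite -(big_mkord xpredT (fun i => f (z i.+1) - f (z i))) telescope_sumr// zd z0.
apply: le_trans (ler_norm_sum _ _ _) _; rewrite /norm1 mulr_sumr.
apply: ler_sum => i _; rewrite zS !mxE [`|x 0 i - _|]distrC.
exact: line.
Qed.

End C1b0_lip1.

Unset Implicit Arguments.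
Set Strict Implicit.
Set Printing Implicit Defensive.

Theorem proposition5p1 (R : realType) (d : nat) (d_ge1 : (1 <= d)%N)
  (c : R -> R)
  (c_gt0 : forall x : R, 0 < x -> 0 < c x)
  (c_C1 : C1_pos c)
  (c'_lt0 : forall x : R, 0 < x -> (c^`())%classic x < 0)
  (c_convex :
    convex_function (`]0, +oo[%classic : set R) (fun x => c x / (c^`())%classic x))
  (c_lim0 : exists l : R, c x @[x --> (0 : R)^'+] --> l)
  (v : R -> R -> R)
  (v_inv : forall t : R, 0 <= t -> forall x : R, 0 < x -> v t (u c t x) = x)
  (f : 'rV[R]_d -> R) (f_C1b0 : C1b0 f) (t : R) (t_ge0 : 0 <= t) :
  v t (gaussian_norm1 (fun x => u c t (ornstein_uhlenbeck t f x))) >=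
  v 0 (gaussian_norm1 (fun x => u c 0 (f x))).
Proof.
case: f_C1b0 => f_bnd f_der _ fp_bnd f_inf.
have [L L0 fL] := bounded_partial_lip1 f_der fp_bnd.
have [B fB] : exists B, forall x, `|f x| <= B.
  have [M [_ hM]] := f_bnd; exists (M + 1) => x.
  by apply: (hM (M + 1)) => //; rewrite ltrDl.
set a := inf (range f) in f_inf.
have fab z : a <= f z <= B.
  apply/andP; split; last exact: le_trans (ler_norm _) (fB z).
  apply: ge_inf; last by exists z.
  exists (- B) => _ [x _ <-].
  by rewrite lerNl; apply: le_trans (fB x); rewrite -normrN; exact: ler_norm.
have aB : a <= B by have /andP[h1 h2] := fab 0; exact: le_trans h2.
have so s := u_second_order c_gt0 c_C1 c'_lt0 c_lim0 s f_inf aB.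
have [k0 [K0 [Q0 so0]]] := so 0.
have [kt [Kt [Qt sot]]] := so t.
have P0E : expR (2 * 0) = 1 :> R by rewrite mulr0 expR0.
have P1 : 1 <= expR (2 * t).
  by rewrite -expR0 ler_expR mulr_ge0.
have pos x : a <= x <= B -> 0 < x by move=> /andP[ax _]; exact: lt_le_trans ax.
pose rho x := - (c x / (c^`())%classic x).
have rho_gt0 x : a <= x <= B -> 0 < rho x.
  move=> /pos x0; rewrite /rho -mulrN -invrN mulr_gt0 ?c_gt0// invr_gt0 oppr_gt0.
  exact: c'_lt0.
have onto s w : u c s a <= w <= u c s B ->
    exists2 x, a <= x <= B & u c s x = w.
  move=> /andP[aw wB].
  have uaB : u c s a <= u c s B by exact: le_trans wB.
  have ct : {within `[a, B], continuous (u c s)}.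
    move: c_lim0 => [l hl].
    apply: derivable_within_continuous => x /[!in_itv]/= /pos x0.
    by have [] := primitive_is_derive c_gt0 c_C1 c'_lt0 hl (expR_gt0 (2 * s)) x0.
  have [|x xaB xE] := IVT aB ct (v := w).
    by rewrite min_l// max_r// aw.
  by exists x => //; move: xaB; rewrite in_itv.
have K00 := so_K_ge0 so0 aB; have Kt0 := so_K_ge0 sot aB.
have bf := bl_itv L0 fL fab.
have bpf := bl_so so0 K00 L0 fL fab.
pose p := expR (2 * t).
have pV : p^-1 = expR (- (2 * t)) by rewrite expRN.
pose g := heat (1 - p^-1) f.
have gL : lip1 L g by exact: lip1_heat.
have gab z : a <= g z <= B by exact: heat_itv.
have bpg := bl_so sot Kt0 L0 gL gab.
have E0 : gaussian_norm1 (fun x => u c 0 (f x)) = heat 1 (u c 0 \o f) 0.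
  rewrite /gaussian_norm1 /heat; congr gaussian_integral; apply/funext => y.
  by rewrite (ger0_norm (u_ge0 _ _ _)) sqrtr1 scale1r add0r.
have OUE y : ornstein_uhlenbeck t f y = g (0 + Num.sqrt p^-1 *: y).
  rewrite /ornstein_uhlenbeck /g /heat add0r pV; congr gaussian_integral.
  apply/funext => z; congr (f (_ *: _ + _)).
  by rewrite mulr_natl mulr2n opprD expRD -expr2 sqrtr_sqr ger0_norm// expR_ge0.
have Et : gaussian_norm1 (fun x => u c t (ornstein_uhlenbeck t f x)) =
    heat p^-1 (u c t \o g) 0.
  rewrite /gaussian_norm1 [RHS]/heat; congr gaussian_integral; apply/funext => y.
  by rewrite (ger0_norm (u_ge0 _ _ _)) OUE.
have [mu0 mu0ab mu0E] : exists2 x, a <= x <= B & u c 0 x = heat 1 (u c 0 \o f) 0.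
  by apply: onto; apply: heat_itv => // z; exact: (so_itv so0).
have [mut mutab mutE] : exists2 x, a <= x <= B & u c t x = heat p^-1 (u c t \o g) 0.
  by apply: onto; apply: heat_itv => // z; exact: (so_itv sot).
rewrite [X in v 0 X]E0 [X in v t X]Et -[X in v 0 X]mu0E -[X in v t X]mutE.
rewrite (v_inv 0 (lexx 0) _ (pos _ mu0ab)) (v_inv t t_ge0 _ (pos _ mutab)).
have q0E x : a <= x <= B -> expR (2 * 0) * ((c^`())%classic x / c x) = - (rho x)^-1.
  by move=> _; rewrite P0E mul1r /rho invrN opprK invf_div.
have qtE x : a <= x <= B -> p * ((c^`())%classic x / c x) = - (p / rho x).
  by move=> _; rewrite /rho invrN mulrN opprK invf_div.
have rho_conc x : a <= x <= B ->
    exists w, forall y, a <= y <= B -> rho y <= rho x + w * (y - x).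
  move=> /pos x0; have [w hw] := convex_support c_convex x0.
  by exists (- w) => y /pos y0; rewrite /rho mulNr -opprD lerN2; exact: hw.
exact: (heat_mean_le aB so0 sot P1 rho_gt0 q0E qtE rho_conc (onto 0) (onto t)
  L0 fL fab mu0ab mu0E mutab mutE).
Qed.
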